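(* Let $\Bbbk$ be a commutative ring with unit and let $A$ be an ordinary (ungraded) unital associative $\Bbbk$-algebra whose underlying $\Bbbk$-module is finitely generated and free. Let $n,d$ be positive integers with $n\ge d$. Then there is an equivalence of categories $$\mathcal P_{d,\mathcal V_A}\ \xrightarrow{\ \sim\ }\ S^A(n,d)\text{-}\mathrm{mod}.$$
   Context: $\mathcal V_\Bbbk$ is the category of finitely generated projective $\Bbbk$-modules and $\Bbbk$-linear maps, and $\mathcal V_A$ is the category of finitely generated projective right $A$-modules and $A$-linear maps. For $M\in\mathcal V_\Bbbk$, $\Gamma^dM:=(M^{\otimes d})^{\mathfrak S_d}$ is the module of invariants under permutation of the tensor factors (tensor products over $\Bbbk$). For $f:M\to N$, $\Gamma^d(f)$ is the restriction of $f^{\otimes d}$. There is a map $\psi^d:\Gamma^dM\otimes\Gamma^dN\to\Gamma^d(M\otimes N)$, the restriction of the canonical isomorphism $M^{\otimes d}\otimes N^{\otimes d}\cong(M\otimes N)^{\otimes d}$. For a $\Bbbk$-linear category $\mathcal C$ whose hom-modules lie in $\mathcal V_\Bbbk$, the category $\Gamma^d\mathcal C$ has the same objects as $\mathcal C$, morphisms $\mathrm{Hom}_{\Gamma^d\mathcal C}(X,Y):=\Gamma^d\mathrm{Hom}_{\mathcal C}(X,Y)$, and composition given by $\psi^d$ followed by $\Gamma^d$ of the composition map $\mathrm{Hom}_{\mathcal C}(Y,Z)\otimes\mathrm{Hom}_{\mathcal C}(X,Y)\to\mathrm{Hom}_{\mathcal C}(X,Z)$. The category $\mathcal P_{d,\mathcal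 C}$ is the category of all $\Bbbk$-linear functors $\Gamma^d\mathcal C\to\mathcal V_\Bbbk$ and natural transformations. The generalized Schur algebra is $S^A(n,d):=\Gamma^d M_n(A)$, where $M_n(A)=\mathrm{End}_A(A^n)$ is the algebra of $n\times n$ matrices over $A$; it is a subalgebra of $M_n(A)^{\otimes d}$. $S^A(n,d)\text{-}\mathrm{mod}$ denotes the category of finitely generated left $S^A(n,d)$-modules, with all module homomorphisms.
   Formalization: As stated this fails for k = A = Z, n = d = 1; the formal theorem takes as target the finitely generated left S^A(n,d)-modules that are projective over k, and all of S^A(n,d)-mod when every finitely generated k-module is projective. *)

(* Defs.v *)
From HB Require Import structures.
From mathcomp Require Import all_boot all_order all_fingroup all_algebra.
From mathcomp Require Import generic_quotient boolp.

Set Implicit Arguments.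
Unset Strict Implicit.
Unset Printing Implicit Defensive.

Import GRing.Theory.
Local Open Scope quotient_scope.
Local Open Scope ring_scope.

(* A unital associative k-algebra: a ring with a central structure map from k.
   Unlike [algType], the trivial ring is allowed, so that neither the zero
   algebra nor the zero base ring is excluded below. *)

HB.mixin Record hasAlgMap (k : comPzRingType) A of GRing.PzRing A := {
  alg_map : k -> A;
  alg_map1 : alg_map 1 = 1;
  alg_mapD : {morph alg_map : a b / a + b};
  alg_mapM : {morph alg_map : a b / a * b};
  alg_mapC : forall (c : k) (x : A), alg_map c * x = x * alg_map c
}.

#[short(type="pzAlgType")]
HB.structure Definition PzAlgebra (k : comPzRingType) :=
  {A of GRing.PzRing A & hasAlgMap k A}.

HB.instance Definition _ (k : comPzRingType) :=
  hasAlgMap.Build k k (erefl 1) (fun _ _ => erefl) (fun _ _ => erefl)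
    (@mulrC k).

Section Algebras.
Variables (k : comPzRingType) (A : pzAlgType k) (n : nat).
Local Notation iota := (@alg_map k A).

Lemma alg_map_converseM : {morph (iota : k -> A^c) : a b / a * b}.
Proof. by move=> a b; rewrite mulrC alg_mapM. Qed.

HB.instance Definition _ := hasAlgMap.Build k A^c
  (@alg_map1 k A) (@alg_mapD k A) alg_map_converseM
  (fun c x => esym (@alg_mapC k A c x)).

Definition mx_alg_map (c : k) : 'M[A]_n := (iota c)%:M.

Lemma mx_alg_map1 : mx_alg_map 1 = 1.
Proof. by rewrite /mx_alg_map alg_map1. Qed.

Lemma mx_alg_mapD : {morph mx_alg_map : a b / a + b}.
Proof. by move=> a b; rewrite /mx_alg_map alg_mapD raddfD. Qed.

Lemma mx_alg_mapM : {morph mx_alg_map : a b / a * b}.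
Proof. by move=> a b; rewrite /mx_alg_map alg_mapM; exact: scalar_mxM. Qed.

Lemma mx_alg_mapC (c : k) (X : 'M[A]_n) : mx_alg_map c * X = X * mx_alg_map c.
Proof.
apply/matrixP => i j; rewrite !mxE (bigD1 i) //= [RHS](bigD1 j) //=.
rewrite !mxE !eqxx !mulr1n alg_mapC !big1 // => l nl; rewrite mxE.
  by rewrite (negPf nl) mulr0.
by rewrite eq_sym (negPf nl) mul0r.
Qed.

HB.instance Definition _ := hasAlgMap.Build k 'M[A]_n
  mx_alg_map1 mx_alg_mapD mx_alg_mapM mx_alg_mapC.

End Algebras.

Definition fin_gen (R : pzRingType) (M : lmodType R) : Prop :=
  exists (m : nat) (e : 'I_m -> M),
    forall x : M, exists c : 'I_m -> R, x = \sum_i c i *: e i.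

Definition fin_free (R : pzRingType) (M : lmodType R) : Prop :=
  exists (m : nat) (e : 'I_m -> M),
    forall x : M, exists! c : 'rV[R]_m, x = \sum_i c 0 i *: e i.

Definition projective (R : pzRingType) (P : lmodType R) : Prop :=
  forall (M N : lmodType R) (g : {linear M -> N}) (f : {linear P -> N}),
    (forall y, exists x, g x = y) ->
    exists h : {linear P -> M}, forall x, g (h x) = f x.

Definition restr (k : comPzRingType) (R : pzAlgType k) (M : lmodType R) : Type :=
  M.

Section Restriction.
Variables (k : comPzRingType) (R : pzAlgType k) (M : lmodType R).

HB.instance Definition _ := GRing.Zmodule.on (restr M).

Definition restr_scale (c : k) (x : restr M) : restr M :=
  (alg_map c : R) *: (x : M).

Lemma restr_scaleA a b x : restr_scale a (restr_scale b x) = restr_scale (a * b) x.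
Proof. by rewrite /restr_scale scalerA alg_mapM. Qed.

Lemma restr_scale1 : left_id 1 restr_scale.
Proof. by move=> x; rewrite /restr_scale alg_map1 scale1r. Qed.

Lemma restr_scaleDr : right_distributive restr_scale +%R.
Proof. by move=> a x y; rewrite /restr_scale scalerDr. Qed.

Lemma restr_scaleDl x : {morph restr_scale^~ x : a b / a + b}.
Proof. by move=> a b; rewrite /restr_scale alg_mapD scalerDl. Qed.

HB.instance Definition _ := GRing.Zmodule_isLmodule.Build k (restr M)
  restr_scaleA restr_scale1 restr_scaleDr restr_scaleDl.

End Restriction.

(* The k-module underlying a k-algebra. *)
Notation kmod R := (restr (R^o : lmodType R)).

Definition lhom (k : comPzRingType) (R : pzAlgType k) (U V : lmodType R) : Type :=
  {linear U -> V}.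

Lemma lhom_ext (R : pzRingType) (U V : lmodType R) (f g : {linear U -> V}) :
  f =1 g -> f = g.
Proof.
move=> /funext; case: f g => [f [[f1] [f2]]] [g [[g1] [g2]]] /= efg.
move: f1 f2 g1 g2; rewrite efg => f1 f2 g1 g2.
by rewrite (Prop_irrelevance f1 g1) (Prop_irrelevance f2 g2).
Qed.

Definition lhom_of (R : pzRingType) (U V : lmodType R) (f : U -> V)
    (fP : linear f) : {linear U -> V} :=
  HB.pack f (GRing.isLinear.Build R U V *:%R f fP).

Section LinearMaps.
Variables (k : comPzRingType) (R : pzAlgType k) (U V : lmodType R).
Local Notation H := (lhom U V).
Implicit Types f g h : {linear U -> V}.

HB.instance Definition _ := gen_eqMixin H.
HB.instance Definition _ := gen_choiceMixin H.

Lemma lhom_zeroP : linear (fun _ : U => 0 : V).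
Proof. by move=> a x y; rewrite scaler0 addr0. Qed.

Lemma lhom_addP f g : linear (fun x => f x + g x).
Proof. by move=> a x y; rewrite !linearP scalerDr addrACA. Qed.

Lemma lhom_oppP f : linear (fun x => - f x).
Proof. by move=> a x y; rewrite linearP opprD scalerN. Qed.

Lemma lhom_scaleP (c : k) f : linear (fun x => (alg_map c : R) *: f x).
Proof.
by move=> a x y; rewrite linearP scalerDr !scalerA alg_mapC.
Qed.

Definition lhom_zero : H := lhom_of lhom_zeroP.
Definition lhom_add (f g : H) : H := lhom_of (lhom_addP f g).
Definition lhom_opp (f : H) : H := lhom_of (lhom_oppP f).
Definition lhom_scale (c : k) (f : H) : H := lhom_of (lhom_scaleP c f).

Lemma lhom_addA : associative lhom_add.
Proof. by move=> f g h; apply: lhom_ext => x /=; rewrite addrA. Qed.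

Lemma lhom_addC : commutative lhom_add.
Proof. by move=> f g; apply: lhom_ext => x /=; rewrite addrC. Qed.

Lemma lhom_add0 : left_id lhom_zero lhom_add.
Proof. by move=> f; apply: lhom_ext => x /=; rewrite add0r. Qed.

Lemma lhom_addN : left_inverse lhom_zero lhom_opp lhom_add.
Proof. by move=> f; apply: lhom_ext => x /=; rewrite addNr. Qed.

HB.instance Definition _ :=
  GRing.isZmodule.Build H lhom_addA lhom_addC lhom_add0 lhom_addN.

Lemma lhom_scaleA a b f : lhom_scale a (lhom_scale b f) = lhom_scale (a * b) f.
Proof. by apply: lhom_ext => x /=; rewrite scalerA alg_mapM. Qed.

Lemma lhom_scale1 : left_id 1 lhom_scale.
Proof. by move=> f; apply: lhom_ext => x /=; rewrite alg_map1 scale1r. Qed.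

Lemma lhom_scaleDr : right_distributive lhom_scale +%R.
Proof. by move=> a f g; apply: lhom_ext => x /=; rewrite scalerDr. Qed.

Lemma lhom_scaleDl f : {morph lhom_scale^~ f : a b / a + b}.
Proof. by move=> a b; apply: lhom_ext => x /=; rewrite alg_mapD scalerDl. Qed.

HB.instance Definition _ := GRing.Zmodule_isLmodule.Build k H
  lhom_scaleA lhom_scale1 lhom_scaleDr lhom_scaleDl.

End LinearMaps.

Section LinearComposition.
Variables (k : comPzRingType) (R : pzAlgType k).

Definition lhom_id (U : lmodType R) : lhom U U := [the {linear U -> U} of idfun].

Definition lhom_comp (U V W : lmodType R) (g : lhom V W) (f : lhom U V) :
  lhom U W := [the {linear U -> W} of (g : {linear V -> W}) \o (f : {linear U -> V})].

End LinearComposition.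

Definition bilinear_map (k : pzRingType) (M N P : lmodType k)
    (b : M -> N -> P) : Prop :=
  (forall y, linear (b^~ y)) /\ (forall x, linear (b x)).

Section CompBilinear.
Variables (k : comPzRingType) (R : pzAlgType k) (U V W : lmodType R).

Lemma lhom_comp_bilinear : bilinear_map (@lhom_comp k R U V W).
Proof.
split=> [f c g g'|g c f f']; apply: lhom_ext => x //=.
by rewrite linearD linearZ.
Qed.

End CompBilinear.

(* Tensor powers over k: formal sums of pairs (coefficient, d-tuple of
   elements of M), modulo the congruence generated by additivity in the
   coefficient and linearity in each of the d slots. *)

Definition upd (d : nat) (T : Type) (v : {ffun 'I_d -> T}) (i : 'I_d) (x : T) :
  {ffun 'I_d -> T} := [ffun j => if j == i then x else v j].

Definition multilinear (k : pzRingType) (d : nat) (M W : lmodType k)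
    (phi : {ffun 'I_d -> M} -> W) : Prop :=
  forall v i c x y,
    phi (upd v i (c *: x + y)) = c *: phi (upd v i x) + phi (upd v i y).

Section TensorPower.
Variables (k : comPzRingType) (d : nat) (M : lmodType k).

Local Notation tup := {ffun 'I_d -> M}.
Definition formal_sum : Type := seq (k * tup).
HB.instance Definition _ := Choice.on formal_sum.
Implicit Types s t : formal_sum.

Inductive tens_rel : formal_sum -> formal_sum -> Prop :=
| tens_perm s t : perm_eq s t -> tens_rel s t
| tens_sym s t : tens_rel s t -> tens_rel t s
| tens_trans s t u : tens_rel s t -> tens_rel t u -> tens_rel s u
| tens_cat s s' t t' :
    tens_rel s s' -> tens_rel t t' -> tens_rel (s ++ t) (s' ++ t')
| tens_coef0 v : tens_rel [:: (0, v)] [::]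
| tens_coefD a b v : tens_rel [:: (a + b, v)] [:: (a, v); (b, v)]
| tens_slot a v i c x y :
    tens_rel [:: (a, upd v i (c *: x + y))]
             [:: (a * c, upd v i x); (a, upd v i y)].

Definition tens_relb s t : bool := `[< tens_rel s t >].

Lemma tens_refl s : tens_rel s s.
Proof. exact: tens_perm. Qed.

Lemma tens_relb_equiv : equiv_class_of tens_relb.
Proof.
split=> [s|s t|t s u].
- by apply/asboolP/tens_refl.
- by apply/asboolP/asboolP => /tens_sym.
- by move=> /asboolP st /asboolP tu; apply/asboolP/(tens_trans st tu).
Qed.

Canonical tens_equiv := EquivRelPack tens_relb_equiv.

Definition tpow : Type := {eq_quot tens_equiv}.
HB.instance Definition _ := Choice.on tpow.
HB.instance Definition _ := EqQuotient.on tpow.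

Definition tclass (s : formal_sum) : tpow := \pi_tpow s.

Lemma tclassP s t : tclass s = tclass t <-> tens_rel s t.
Proof.
split=> [/eqmodP/asboolP //|st]; by apply/eqmodP/asboolP.
Qed.

Lemma tclassK x : tclass (repr x) = x.
Proof. exact: reprK. Qed.

Lemma repr_tclass s : tens_rel (repr (tclass s)) s.
Proof. by apply/tclassP; rewrite tclassK. Qed.

Definition fscale (c : k) s : formal_sum := [seq (c * p.1, p.2) | p <- s].

Definition tadd (x y : tpow) : tpow := tclass (repr x ++ repr y).
Definition tscale (c : k) (x : tpow) : tpow := tclass (fscale c (repr x)).

Lemma taddE s t : tadd (tclass s) (tclass t) = tclass (s ++ t).
Proof. by apply/tclassP/tens_cat; apply: repr_tclass. Qed.

Lemma fscale_rel c s t : tens_rel s t -> tens_rel (fscale c s) (fscale c t).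
Proof.
elim=> {s t} [s t st|s t _ st|s t u _ st _ tu|s s' t t' _ ss _ tt|v|a b v|a v i e x y].
- exact/tens_perm/perm_map.
- exact: tens_sym.
- exact: tens_trans st tu.
- by rewrite /fscale !map_cat; apply: tens_cat.
- by rewrite /= mulr0; apply: tens_coef0.
- by rewrite /= mulrDr; apply: tens_coefD.
- by rewrite /= mulrA; apply: tens_slot.
Qed.

Lemma tscaleE c s : tscale c (tclass s) = tclass (fscale c s).
Proof. by apply/tclassP/fscale_rel/repr_tclass. Qed.

Lemma tpowP x : exists s, x = tclass s.
Proof. by exists (repr x); rewrite tclassK. Qed.

Lemma taddA : associative tadd.
Proof.
move=> x y z; have [s ->] := tpowP x; have [t ->] := tpowP y.
by have [u ->] := tpowP z; rewrite !taddE catA.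
Qed.

Lemma taddC : commutative tadd.
Proof.
move=> x y; have [s ->] := tpowP x; have [t ->] := tpowP y.
by rewrite !taddE; apply/tclassP/tens_perm; rewrite perm_catC.
Qed.

Lemma tadd0 : left_id (tclass [::]) tadd.
Proof. by move=> x; have [s ->] := tpowP x; rewrite taddE. Qed.

Lemma fscaleDl a b s : tens_rel (fscale (a + b) s) (fscale a s ++ fscale b s).
Proof.
elim: s => [|[c v] s IHs] /=; first exact: tens_refl.
apply: (@tens_trans _ ([:: (a * c, v); (b * c, v)] ++ (fscale a s ++ fscale b s))).
  by rewrite -cat1s; apply: tens_cat => //; rewrite mulrDl; apply: tens_coefD.
by apply: tens_perm; rewrite /= perm_cons -cat1s perm_catCA.
Qed.

Lemma fscale0 s : tens_rel (fscale 0 s) [::].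
Proof.
elim: s => [|[c v] s IHs] /=; first exact: tens_refl.
by rewrite mul0r -cat1s -[[::]]/([::] ++ [::]); apply: tens_cat => //; apply: tens_coef0.
Qed.

Lemma fscale1 s : fscale 1 s = s.
Proof. by elim: s => [|[c v] s IHs] //=; rewrite mul1r IHs. Qed.

Lemma taddN : left_inverse (tclass [::]) (tscale (-1)) tadd.
Proof.
move=> x; have [s ->] := tpowP x; rewrite tscaleE taddE; apply/tclassP.
apply: tens_trans (fscale0 s); rewrite -(addNr 1); apply: tens_sym.
by rewrite -[in X in _ ++ X](fscale1 s); apply: fscaleDl.
Qed.

HB.instance Definition _ := GRing.isZmodule.Build tpow taddA taddC tadd0 taddN.

Lemma tscaleA a b x : tscale a (tscale b x) = tscale (a * b) x.
Proof.
have [s ->] := tpowP x; rewrite !tscaleE /fscale -map_comp.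
by congr tclass; apply: eq_map => p /=; rewrite mulrA.
Qed.

Lemma tscale1 : left_id 1 tscale.
Proof. by move=> x; have [s ->] := tpowP x; rewrite tscaleE fscale1. Qed.

Lemma tscaleDr : right_distributive tscale +%R.
Proof.
move=> a x y; have [s ->] := tpowP x; have [t ->] := tpowP y.
by rewrite -[_ + _]/(tadd _ _) -[RHS]/(tadd _ _) taddE !tscaleE taddE /fscale map_cat.
Qed.

Lemma tscaleDl x : {morph tscale^~ x : a b / a + b}.
Proof.
move=> a b; have [s ->] := tpowP x.
by rewrite -[RHS]/(tadd _ _) !tscaleE taddE; apply/tclassP/fscaleDl.
Qed.

HB.instance Definition _ :=
  GRing.Zmodule_isLmodule.Build k tpow tscaleA tscale1 tscaleDr tscaleDl.

(* The pure tensor v 0 (x) ... (x) v (d - 1). *)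
Definition tpure (v : tup) : tpow := tclass [:: (1, v)].

Lemma tclass_sum s : tclass s = \sum_(p <- s) p.1 *: tpure p.2.
Proof.
elim: s => [|[c v] s IHs]; first by rewrite big_nil.
rewrite big_cons -IHs -cat1s -taddE; congr (tadd _ _) => /=.
by rewrite -[RHS]/(tscale _ _) tscaleE /= mulr1.
Qed.

Lemma tpure_multilinear : multilinear tpure.
Proof.
move=> v i c x y; transitivity (tclass [:: (1 * c, upd v i x); (1, upd v i y)]).
  exact/tclassP/tens_slot.
by rewrite tclass_sum big_cons big_seq1 mul1r scale1r.
Qed.

(* The linear map induced by [phi]; meaningful when [phi] is multilinear. *)
Definition tlift (W : lmodType k) (phi : tup -> W) (x : tpow) : W :=
  \sum_(p <- repr x) p.1 *: phi p.2.

Section Lift.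
Variables (W : lmodType k) (phi : tup -> W).
Hypothesis phiP : multilinear phi.

Lemma tlift_class s : tlift phi (tclass s) = \sum_(p <- s) p.1 *: phi p.2.
Proof.
rewrite /tlift; move: (repr _) (repr_tclass s) => r; elim=> {r s}
    [s t st|s t _ -> //|s t u _ -> _ -> //|s s' t t' _ ss _ tt|v|a b v|a v i e x y].
- exact: perm_big.
- by rewrite !big_cat ss tt.
- by rewrite big_seq1 big_nil scale0r.
- by rewrite !big_cons !big_nil /= !addr0 scalerDl.
- by rewrite !big_cons !big_nil /= !addr0 phiP scalerDr scalerA.
Qed.

Lemma tlift_linear : linear (tlift phi).
Proof.
move=> c x y; have [s ->] := tpowP x; have [t ->] := tpowP y.
rewrite -[c *: _]/(tscale _ _) -[_ + _]/(tadd _ _) tscaleE taddE !tlift_class.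
rewrite big_cat big_map scaler_sumr; congr (_ + _).
by apply: eq_bigr => p _; rewrite scalerA.
Qed.

Lemma tlift_pure v : tlift phi (tpure v) = phi v.
Proof. by rewrite tlift_class big_seq1 scale1r. Qed.

End Lift.

Lemma tpow_ext (W : lmodType k) (f g : tpow -> W) : linear f -> linear g ->
  (forall v, f (tpure v) = g (tpure v)) -> f =1 g.
Proof.
move=> fL gL fg x; have [s ->] := tpowP x.
pose f' : {linear tpow -> W} := lhom_of fL; pose g' : {linear tpow -> W} := lhom_of gL.
rewrite tclass_sum -[LHS]/(f' _) -[RHS]/(g' _) !linear_sum.
by apply: eq_bigr => p _; rewrite !linearZ /= fg.
Qed.

End TensorPower.

(* Places are permuted by the symmetric group, and the divided power Gamma^d M
   consists of the invariant tensors. *)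

Section DividedPower.
Variables (k : comPzRingType) (d : nat) (M : lmodType k).
Local Notation T := (tpow d M).

Definition perm_tuple (s : 'S_d) (v : {ffun 'I_d -> M}) : {ffun 'I_d -> M} :=
  [ffun i => v (s i)].

Lemma perm_tuple_upd s v i x :
  perm_tuple s (upd v i x) = upd (perm_tuple s v) ((s^-1)%g i) x.
Proof. by apply/ffunP => j; rewrite !ffunE (canF_eq (permK s)). Qed.

Definition tact (s : 'S_d) : T -> T := tlift (fun v => tpure (perm_tuple s v)).

Lemma perm_tuple_multilinear s :
  multilinear (fun v => tpure (perm_tuple s v) : T).
Proof. by move=> v i c x y; rewrite !perm_tuple_upd tpure_multilinear. Qed.

Lemma tact_linear s : linear (tact s).
Proof. exact/tlift_linear/perm_tuple_multilinear. Qed.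

Lemma tact_pure s v : tact s (tpure v) = tpure (perm_tuple s v).
Proof. exact/tlift_pure/perm_tuple_multilinear. Qed.

Definition tsym : {pred T} := [pred x | [forall s : 'S_d, tact s x == x]].

Lemma tsymP x : reflect (forall s, tact s x = x) (x \in tsym).
Proof. exact: 'forall_eqP. Qed.

Lemma tsym_submod_closed : submod_closed tsym.
Proof.
split=> [|c x y /tsymP xP /tsymP yP]; apply/tsymP => s.
  by have := tact_linear s (-1) 0 0; rewrite scaler0 addr0 scaleN1r addNr.
by rewrite tact_linear xP yP.
Qed.

HB.instance Definition _ :=
  GRing.isSubmodClosed.Build k T tsym tsym_submod_closed.

Record gamma : Type := Gamma { gval : T; gvalP : gval \in tsym }.

HB.instance Definition _ := [isSub for gval].
HB.instance Definition _ := [Choice of gamma by <:].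
HB.instance Definition _ := [SubChoice_isSubLmodule of gamma by <:].

Lemma gpure_sym (m : M) : tpure [ffun=> m] \in tsym.
Proof.
apply/tsymP => s; rewrite tact_pure; congr tpure.
by apply/ffunP => i; rewrite !ffunE.
Qed.

(* m (x) ... (x) m *)
Definition gpure (m : M) : gamma := Gamma (gpure_sym m).

End DividedPower.

(* A bilinear map b : M x N -> P acts factorwise on tensor powers,
     (m_1 (x) ... (x) m_d, n_1 (x) ... (x) n_d)
        |-> b (m_1, n_1) (x) ... (x) b (m_d, n_d);
   viewed as a linear map on the tensor product of the tensor powers, this is
   the canonical isomorphism onto the d-th power of M (x) N, followed by the
   d-th power of the linear map M (x) N -> P.  Its restriction [gbilin] to
   invariants is thus psi^d followed by Gamma^d (M (x) N -> P). *)

Section FactorwiseBilinear.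
Variables (k : comPzRingType) (d : nat) (M N P : lmodType k).
Variables (b : M -> N -> P).

Definition bpure (v : {ffun 'I_d -> M}) (w : {ffun 'I_d -> N}) : tpow d P :=
  tpure [ffun i => b (v i) (w i)].

Definition tbilin (x : tpow d M) (y : tpow d N) : tpow d P :=
  tlift (fun v => tlift (bpure v) y) x.

Hypothesis bP : bilinear_map b.

Lemma bpure_multil w : multilinear (bpure^~ w).
Proof.
move=> v i c x y; rewrite /bpure.
have E z : [ffun j => b (upd v i z j) (w j)] =
           upd [ffun j => b (v j) (w j)] i (b z (w i)).
  by apply/ffunP => j; rewrite !ffunE; case: eqP => // ->.
by rewrite !E bP.1 tpure_multilinear.
Qed.

Lemma bpure_multir v : multilinear (bpure v).
Proof.
move=> w i c x y; rewrite /bpure.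
have E z : [ffun j => b (v j) (upd w i z j)] =
           upd [ffun j => b (v j) (w j)] i (b (v i) z).
  by apply/ffunP => j; rewrite !ffunE; case: eqP => // ->.
by rewrite !E bP.2 tpure_multilinear.
Qed.

Lemma tbilin_multi y : multilinear (fun v => tlift (bpure v) y).
Proof.
move=> v i c x x'; rewrite /tlift scaler_sumr -big_split.
apply: eq_bigr => p _ /=.
by rewrite bpure_multil scalerDr !scalerA [c * _]mulrC.
Qed.

Lemma tbilin_pure v w : tbilin (tpure v) (tpure w) = bpure v w.
Proof.
by rewrite /tbilin (tlift_pure (@tbilin_multi _)) (tlift_pure (@bpure_multir _)).
Qed.

Lemma tbilin_bilinear : bilinear_map tbilin.
Proof.
split=> [y|x]; first exact/tlift_linear/tbilin_multi.
move=> c y y'; rewrite /tbilin /tlift scaler_sumr -big_split.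
apply: eq_bigr => p _; rewrite -[\sum_(_ <- repr _) _]/(tlift (bpure p.2) _).
by rewrite (tlift_linear (@bpure_multir _)) scalerDr !scalerA [c * _]mulrC.
Qed.

Lemma tact_tbilin s x y : tact s (tbilin x y) = tbilin (tact s x) (tact s y).
Proof.
have [bl br] := tbilin_bilinear; have tL := @tact_linear k d.
move: x; apply: tpow_ext => [c x x'|c x x'|v]; rewrite ?tL ?bl ?tL //.
move: y; apply: tpow_ext => [c x x'|c x x'|w]; rewrite ?tL ?br ?tL //.
rewrite !tact_pure !tbilin_pure tact_pure; congr tpure.
by apply/ffunP => i; rewrite !ffunE.
Qed.

Lemma gbilin_sym (x : gamma d M) (y : gamma d N) :
  tbilin (gval x) (gval y) \in @tsym k d P.
Proof.
apply/tsymP => s; rewrite tact_tbilin.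
by rewrite (tsymP _ (gvalP x)) (tsymP _ (gvalP y)).
Qed.

Definition gbilin (x : gamma d M) (y : gamma d N) : gamma d P :=
  Gamma (gbilin_sym x y).

Lemma gbilin_bilinear : bilinear_map gbilin.
Proof.
by split=> [y c x x'|x c y y']; apply: val_inj;
  rewrite /= ?tbilin_bilinear.1 ?tbilin_bilinear.2.
Qed.

End FactorwiseBilinear.
Arguments tbilin_bilinear {k d M N P b}.
Arguments gbilin_bilinear {k d M N P b}.

Lemma tpow_ext3 (k : comPzRingType) (d : nat) (M1 M2 M3 W : lmodType k)
    (f g : tpow d M1 -> tpow d M2 -> tpow d M3 -> W) :
  (forall y z, linear (fun x => f x y z)) ->
  (forall x z, linear (fun y => f x y z)) -> (forall x y, linear (f x y)) ->
  (forall y z, linear (fun x => g x y z)) ->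
  (forall x z, linear (fun y => g x y z)) -> (forall x y, linear (g x y)) ->
  (forall u v w, f (tpure u) (tpure v) (tpure w) =
                 g (tpure u) (tpure v) (tpure w)) ->
  forall x y z, f x y z = g x y z.
Proof.
move=> f1 f2 f3 g1 g2 g3 fg x y z.
move: x; apply: tpow_ext => // u; move: y; apply: tpow_ext => // v.
by move: z; apply: tpow_ext => // w.
Qed.

Section GammaLaws.
Variables (k : comPzRingType) (d : nat).

Lemma gbilinA (M1 M2 M3 M12 M23 W : lmodType k)
    (b12 : M1 -> M2 -> M12) (b12_3 : M12 -> M3 -> W)
    (b23 : M2 -> M3 -> M23) (b1_23 : M1 -> M23 -> W)
    (P12 : bilinear_map b12) (P12_3 : bilinear_map b12_3)
    (P23 : bilinear_map b23) (P1_23 : bilinear_map b1_23) :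
  (forall x y z, b1_23 x (b23 y z) = b12_3 (b12 x y) z) ->
  forall (x : gamma d M1) (y : gamma d M2) (z : gamma d M3),
    gbilin P1_23 x (gbilin P23 y z) = gbilin P12_3 (gbilin P12 x y) z.
Proof.
move=> bA x y z; apply: val_inj => /=.
move: (gval x) (gval y) (gval z); apply: tpow_ext3.
- by move=> u v c w w'; rewrite (tbilin_bilinear P1_23).1.
- by move=> u v c w w'; rewrite (tbilin_bilinear P23).1 (tbilin_bilinear P1_23).2.
- by move=> u v c w w'; rewrite (tbilin_bilinear P23).2 (tbilin_bilinear P1_23).2.
- by move=> u v c w w'; rewrite (tbilin_bilinear P12).1 (tbilin_bilinear P12_3).1.
- by move=> u v c w w'; rewrite (tbilin_bilinear P12).2 (tbilin_bilinear P12_3).1.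
- by move=> u v c w w'; rewrite (tbilin_bilinear P12_3).2.
move=> u v w; rewrite !tbilin_pure //; congr tpure.
by apply/ffunP => i; rewrite !ffunE.
Qed.

Lemma gbilin_unitl (E M : lmodType k) (b : E -> M -> M)
    (P : bilinear_map b) (e : E) :
  (forall m, b e m = m) -> forall x : gamma d M, gbilin P (gpure d e) x = x.
Proof.
move=> be x; apply: val_inj => /=; move: (gval x); apply: tpow_ext => // [|v].
  exact: (tbilin_bilinear P).2.
by rewrite tbilin_pure //; congr tpure; apply/ffunP => i; rewrite !ffunE.
Qed.

Lemma gbilin_unitr (E M : lmodType k) (b : M -> E -> M)
    (P : bilinear_map b) (e : E) :
  (forall m, b m e = m) -> forall x : gamma d M, gbilin P x (gpure d e) = x.
Proof.
move=> be x; apply: val_inj => /=; move: (gval x); apply: tpow_ext => // [|v].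
  exact: (tbilin_bilinear P).1.
by rewrite tbilin_pure //; congr tpure; apply/ffunP => i; rewrite !ffunE.
Qed.

End GammaLaws.

(* Gamma^d B as a k-algebra (a subalgebra of the d-th tensor power of B). *)

Definition gamma_alg (k : comPzRingType) (d : nat) (B : pzAlgType k) : Type :=
  gamma d (kmod B).

Section GammaAlgebra.
Variables (k : comPzRingType) (d : nat) (B : pzAlgType k).
Local Notation G := (gamma_alg d B).

HB.instance Definition _ := GRing.Lmodule.on G.

Definition alg_mul (x y : kmod B) : kmod B := (x : B) * (y : B).

Lemma alg_mul_bilinear : bilinear_map alg_mul.
Proof.
split=> [y c x x'|x c y y']; rewrite /alg_mul.
  by rewrite mulrDl -mulrA.
by rewrite mulrDr mulrA -alg_mapC -mulrA.
Qed.

Definition galg_one : G := @gpure k d (kmod B) (1 : B).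
Definition galg_mul (x y : G) : G := gbilin alg_mul_bilinear x y.

Lemma galg_mulA : associative galg_mul.
Proof. by apply: gbilinA => x y z; apply: mulrA. Qed.

Lemma galg_mul1 : left_id galg_one galg_mul.
Proof. by apply: gbilin_unitl => x; apply: mul1r. Qed.

Lemma galg_1mul : right_id galg_one galg_mul.
Proof. by apply: gbilin_unitr => x; apply: mulr1. Qed.

Lemma galg_mulDl : left_distributive galg_mul +%R.
Proof.
move=> x y z; have := (@gbilin_bilinear k d _ _ _ _ alg_mul_bilinear).1 z 1 x y.
by rewrite !scale1r.
Qed.

Lemma galg_mulDr : right_distributive galg_mul +%R.
Proof.
move=> x y z; have := (@gbilin_bilinear k d _ _ _ _ alg_mul_bilinear).2 x 1 y z.
by rewrite !scale1r.
Qed.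

HB.instance Definition _ := GRing.Zmodule_isPzRing.Build G
  galg_mulA galg_mul1 galg_1mul galg_mulDl galg_mulDr.

Lemma galg_scaleAl (c : k) (x y : G) : (c *: x) * y = c *: (x * y).
Proof.
have : (c *: x + 0) * y = c *: (x * y) + 0 * y.
  exact: (gbilin_bilinear alg_mul_bilinear).1.
by rewrite mul0r !addr0.
Qed.

Lemma galg_scaleAr (c : k) (x y : G) : x * (c *: y) = c *: (x * y).
Proof.
have : x * (c *: y + 0) = c *: (x * y) + x * 0.
  exact: (gbilin_bilinear alg_mul_bilinear).2.
by rewrite mulr0 !addr0.
Qed.

Definition galg_map (c : k) : G := c *: (1 : G).

Lemma galg_map1 : galg_map 1 = 1.
Proof. exact: scale1r. Qed.

Lemma galg_mapD : {morph galg_map : a b / a + b}.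
Proof. by move=> a b; rewrite /galg_map scalerDl. Qed.

Lemma galg_mapM : {morph galg_map : a b / a * b}.
Proof. by move=> a b; rewrite /galg_map galg_scaleAl mul1r scalerA. Qed.

Lemma galg_mapC (c : k) (x : G) : galg_map c * x = x * galg_map c.
Proof. by rewrite /galg_map galg_scaleAl galg_scaleAr mul1r mulr1. Qed.

HB.instance Definition _ :=
  hasAlgMap.Build k G galg_map1 galg_mapD galg_mapM galg_mapC.

End GammaAlgebra.

Definition schur_alg (k : comPzRingType) (A : pzAlgType k) (n d : nat) :
  pzAlgType k := gamma_alg d 'M[A]_n.

Record category : Type := Category {
  obj :> Type;
  hom : obj -> obj -> Type;
  idm : forall X, hom X X;
  comp : forall X Y Z, hom Y Z -> hom X Y -> hom X Z;
  comp_idl : forall X Y (f : hom X Y), comp (idm Y) f = f;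
  comp_idr : forall X Y (f : hom X Y), comp f (idm X) = f;
  compA : forall X Y Z W (h : hom Z W) (g : hom Y Z) (f : hom X Y),
    comp h (comp g f) = comp (comp h g) f
}.
Arguments idm {c} X.

Record functor (C D : category) : Type := Functor {
  fobj :> C -> D;
  fmap : forall X Y : C, hom X Y -> hom (fobj X) (fobj Y);
  fmap_id : forall X, fmap (idm X) = idm (fobj X);
  fmap_comp : forall X Y Z (g : hom Y Z) (f : hom X Y),
    fmap (comp g f) = comp (fmap g) (fmap f)
}.

Definition functor_id (C : category) : functor C C :=
  @Functor C C id (fun _ _ f => f) (fun _ => erefl) (fun _ _ _ _ _ => erefl).

Section FunctorComposition.
Variables (C D E : category) (G : functor D E) (F : functor C D).

Lemma functor_comp_id X :
  fmap G (fmap F (idm X)) = idm (G (F X)).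
Proof. by rewrite !fmap_id. Qed.

Lemma functor_comp_comp X Y Z (g : hom Y Z) (f : hom X Y) :
  fmap G (fmap F (comp g f)) = comp (fmap G (fmap F g)) (fmap G (fmap F f)).
Proof. by rewrite !fmap_comp. Qed.

Definition functor_comp : functor C E :=
  @Functor C E (fun X => G (F X)) (fun _ _ f => fmap G (fmap F f))
    functor_comp_id functor_comp_comp.

End FunctorComposition.

(* Naturality of the inverse [theta] is automatic. *)
Definition nat_iso (C D : category) (F G : functor C D) : Prop :=
  exists (eta : forall X, hom (F X) (G X)) (theta : forall X, hom (G X) (F X)),
    [/\ forall X Y (f : hom X Y), comp (eta Y) (fmap F f) = comp (fmap G f) (eta X),
        forall X, comp (theta X) (eta X) = idm (F X)
      & forall X, comp (eta X) (theta X) = idm (G X)].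

Definition equivalent (C D : category) : Prop :=
  exists (F : functor C D) (G : functor D C),
    nat_iso (functor_comp G F) (functor_id C) /\
    nat_iso (functor_comp F G) (functor_id D).

Record lin_category (k : comPzRingType) : Type := LinCategory {
  kobj :> Type;
  khom : kobj -> kobj -> lmodType k;
  lidm : forall X, khom X X;
  lcomp : forall X Y Z, khom Y Z -> khom X Y -> khom X Z;
  lcomp_bilinear : forall X Y Z, bilinear_map (@lcomp X Y Z);
  lcomp_idl : forall X Y (f : khom X Y), lcomp (lidm Y) f = f;
  lcomp_idr : forall X Y (f : khom X Y), lcomp f (lidm X) = f;
  lcompA : forall X Y Z W (h : khom Z W) (g : khom Y Z) (f : khom X Y),
    lcomp h (lcomp g f) = lcomp (lcomp h g) f
}.
Arguments lidm {k l} X.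

Section LinearFunctors.
Variables (k : comPzRingType) (C D : lin_category k).

Record lin_functor : Type := LinFunctor {
  lfobj :> C -> D;
  lfmap : forall X Y : C, {linear khom X Y -> khom (lfobj X) (lfobj Y)};
  lfmap_id : forall X, lfmap X X (lidm X) = lidm (lfobj X);
  lfmap_comp : forall X Y Z (g : khom Y Z) (f : khom X Y),
    lfmap X Z (lcomp g f) = lcomp (lfmap Y Z g) (lfmap X Y f)
}.

Record nat_trans (F G : lin_functor) : Type := NatTrans {
  nt :> forall X, khom (F X) (G X);
  nt_natural : forall X Y (f : khom X Y),
    lcomp (nt Y) (lfmap F X Y f) = lcomp (lfmap G X Y f) (nt X)
}.

Lemma nat_trans_ext (F G : lin_functor) (a b : nat_trans F G) :
  (forall X, a X = b X) -> a = b.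
Proof.
case: a b => [a aP] [b bP] /= eab.
have {}eab : a = b by apply: functional_extensionality_dep.
by move: aP bP; rewrite eab => aP bP; rewrite (Prop_irrelevance aP bP).
Qed.

Lemma nat_id_natural (F : lin_functor) X Y (f : khom X Y) :
  lcomp (lidm (F Y)) (lfmap F X Y f) = lcomp (lfmap F X Y f) (lidm (F X)).
Proof. by rewrite lcomp_idl lcomp_idr. Qed.

Definition nat_id (F : lin_functor) : nat_trans F F :=
  NatTrans (nat_id_natural F).

Lemma nat_comp_natural (F G H : lin_functor) (b : nat_trans G H)
    (a : nat_trans F G) X Y (f : khom X Y) :
  lcomp (lcomp (b Y) (a Y)) (lfmap F X Y f) =
  lcomp (lfmap H X Y f) (lcomp (b X) (a X)).
Proof. by rewrite -lcompA nt_natural lcompA nt_natural lcompA. Qed.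

Definition nat_comp (F G H : lin_functor) (b : nat_trans G H)
    (a : nat_trans F G) : nat_trans F H := NatTrans (nat_comp_natural b a).

Lemma nat_comp_idl F G (a : nat_trans F G) : nat_comp (nat_id G) a = a.
Proof. by apply: nat_trans_ext => X /=; rewrite lcomp_idl. Qed.

Lemma nat_comp_idr F G (a : nat_trans F G) : nat_comp a (nat_id F) = a.
Proof. by apply: nat_trans_ext => X /=; rewrite lcomp_idr. Qed.

Lemma nat_compA F G H K (c : nat_trans H K) (b : nat_trans G H)
    (a : nat_trans F G) : nat_comp c (nat_comp b a) = nat_comp (nat_comp c b) a.
Proof. by apply: nat_trans_ext => X /=; rewrite lcompA. Qed.

Definition lin_functor_category : category :=
  Category nat_comp_idl nat_comp_idr nat_compA.

End LinearFunctors.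

(* Modules are left modules.  A right A-module is a module over the converse
   ring, so V_A is [fgp_category A^c]. *)

Record fgp_module (R : pzRingType) : Type := FgpModule {
  fgp_sort :> lmodType R;
  fgp_fin_gen : fin_gen fgp_sort;
  fgp_projective : projective fgp_sort
}.

Section ModuleCategories.
Variables (k : comPzRingType) (R : pzAlgType k).

Lemma lhom_comp_idl (U V : lmodType R) (f : lhom U V) :
  lhom_comp (lhom_id V) f = f.
Proof. exact: lhom_ext. Qed.

Lemma lhom_comp_idr (U V : lmodType R) (f : lhom U V) :
  lhom_comp f (lhom_id U) = f.
Proof. exact: lhom_ext. Qed.

Lemma lhom_compA (U V W Z : lmodType R) (h : lhom W Z) (g : lhom V W)
    (f : lhom U V) : lhom_comp h (lhom_comp g f) = lhom_comp (lhom_comp h g) f.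
Proof. exact: lhom_ext. Qed.

Definition fgp_category : lin_category k :=
  @LinCategory k (fgp_module R) (fun U V => lhom U V)
    (fun U => lhom_id U) (fun U V W => @lhom_comp k R U V W)
    (fun U V W => lhom_comp_bilinear U V W)
    (fun U V f => lhom_comp_idl f) (fun U V f => lhom_comp_idr f)
    (fun U V W Z h g f => lhom_compA h g f).

Definition module_category (Q : lmodType R -> Prop) : category :=
  @Category {M : lmodType R | Q M} (fun U V => lhom (sval U) (sval V))
    (fun U => lhom_id (sval U))
    (fun U V W => @lhom_comp k R (sval U) (sval V) (sval W))
    (fun U V f => lhom_comp_idl f) (fun U V f => lhom_comp_idr f)
    (fun U V W Z h g f => lhom_compA h g f).

End ModuleCategories.

Section GammaCategory.
Variables (k : comPzRingType) (d : nat) (C : lin_category k).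

Definition gamma_comp (X Y Z : C) (g : gamma d (khom Y Z))
    (f : gamma d (khom X Y)) : gamma d (khom X Z) :=
  gbilin (lcomp_bilinear X Y Z) g f.

Definition gamma_idm (X : C) : gamma d (khom X X) := gpure d (lidm X).

Lemma gamma_comp_bilinear X Y Z : bilinear_map (@gamma_comp X Y Z).
Proof. exact: gbilin_bilinear. Qed.

Lemma gamma_comp_idl X Y (f : gamma d (khom X Y)) :
  gamma_comp (gamma_idm Y) f = f.
Proof. by apply: gbilin_unitl => g; apply: lcomp_idl. Qed.

Lemma gamma_comp_idr X Y (f : gamma d (khom X Y)) :
  gamma_comp f (gamma_idm X) = f.
Proof. by apply: gbilin_unitr => g; apply: lcomp_idr. Qed.

Lemma gamma_compA X Y Z W (h : gamma d (khom Z W)) (g : gamma d (khom Y Z))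
    (f : gamma d (khom X Y)) :
  gamma_comp h (gamma_comp g f) = gamma_comp (gamma_comp h g) f.
Proof. by apply: gbilinA => x y z; apply: lcompA. Qed.

Definition gamma_category : lin_category k :=
  @LinCategory k C (fun X Y => gamma d (khom X Y)) gamma_idm gamma_comp
    gamma_comp_bilinear gamma_comp_idl gamma_comp_idr gamma_compA.

End GammaCategory.

(* The hom-modules of C are meant to be finitely generated projective over k,
   as they are for C = V_A when A is; [gamma_category] makes sense without. *)
Definition poly_functors (k : comPzRingType) (d : nat) (C : lin_category k) :
  category := lin_functor_category (gamma_category d C) (fgp_category k).

(* S-mod, the category of all finitely generated left S-modules. *)
Definition fg_mod (k : comPzRingType) (S : pzAlgType k) : category :=
  module_category (fun M : lmodType S => fin_gen M).

(* The finitely generated left S-modules whose underlying k-module is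
   projective.  These are the possible values of a functor in P_{d, V_A}, which
   are objects of V_k.  When k is a field this is all of [fg_mod S]; in general
   it is not, and [fg_mod S] is then too large: for A = k = int and n = d = 1,
   P_{d, V_A} is equivalent to the category of finitely generated free abelian
   groups, where multiplication by 2 on int is monic and epic but not an
   isomorphism, whereas [fg_mod S] is the abelian category of all finitely
   generated abelian groups. *)
Definition fg_kproj_mod (k : comPzRingType) (S : pzAlgType k) : category :=
  module_category (fun M : lmodType S => fin_gen M /\ projective (restr M)).

(* Main.v *)
Require Import Defs.
From HB Require Import structures.
From mathcomp Require Import all_boot all_order all_fingroup all_algebra.
From mathcomp Require Import boolp.
Import Defs.

(** Write C for the category Gamma^d V_A, and X0 for the right module A^n
    viewed as an object of C.  Linear maps act on A^n as matrices, so that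
    S^A(n,d) is Gamma^d of End(A^n), which is the endomorphism algebra of X0
    in C ([schur_end_iso]).  The equivalence is evaluation at X0.

    It is an equivalence by a Morita argument ([morita_equivalence]) that
    only uses one property of X0: in C, the identity of every object P is a
    finite sum of maps b_i a_i with a_i : P -> X0 and b_i : X0 -> P
    ([spanned_through]).  The quasi-inverse sends an S-module M to the
    coinduced functor X |-> Hom_S (Hom_C (X, X0), M).  The natural map
    F X -> Hom_S (Hom_C (X, X0), F X0), x |-> (g |-> F g x), has inverse
    h |-> sum_i F b_i (h a_i), and at X0 evaluation at the identity gives
    Hom_S (S, M) = M.  Hom_S (Hom_C (X, X0), M) lies in V_k because the same
    family embeds it as a direct summand of a finite power of M, by
    h |-> (h a_i)_i.

    The factorization of identities ([free_spans_gamma]) is where d <= n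
    enters.  A dual basis e_j, c_j of P writes the identity of P as a sum of
    rank one maps eps_j = e_j c_j.  Expanding its d-th tensor power yields
    the sum over words w : I_d -> J of eps_(w 0) (x) ... (x) eps_(w (d-1)).
    Words are grouped by the set T of letters that occur in them; each group
    is a symmetric tensor, hence a morphism of C.  As T has at most d <= n
    elements, its letters can be given distinct slots of A^n, and the group
    factors as P -> X0 -> P, the first map being the d-th power of the map
    P -> A^n with coordinate c_t in the slot of t ([divided_power_spanned]).

    Finally, S is finitely generated over k, so that finitely generated
    S-modules are finitely generated over k: expanding an invariant tensor
    on words in the generators, its coordinates are constant on orbits of
    the symmetric group, and the orbit sums generate
    ([gamma_dual_basis_fin_gen]).  The modules that occur as values at X0 are
    therefore those that are finitely generated over S and projective over
    k, and these are all the finitely generated ones when every finitely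
    generated k-module is projective. *)

Set Implicit Arguments.
Unset Strict Implicit.
Unset Printing Implicit Defensive.

Import GRing.Theory.
Local Open Scope ring_scope.

(** * Finitely generated projective modules and dual bases *)

Definition dual_basis (R : pzRingType) (P : lmodType R) (I : finType)
    (e : I -> P) (c : I -> {linear P -> R^o}) : Prop :=
  forall x, x = \sum_i (c i x : R) *: e i.

Definition has_dual_basis (R : pzRingType) (P : lmodType R) : Prop :=
  exists (I : finType) (e : I -> P) (c : I -> {linear P -> R^o}),
    dual_basis e c.

Lemma fin_gen_index (R : pzRingType) (M : lmodType R) (I : finType)
    (e : I -> M) :
  (forall x, exists c : I -> R, x = \sum_i c i *: e i) -> fin_gen M.
Proof.
move=> eP; exists #|I|, (e \o enum_val) => x; have [c ->] := eP x.
exists (c \o enum_val).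
by rewrite -(big_enum_val (A := xpredT) (fun i => c i *: e i)).
Qed.

(** A lift along a surjection is determined by lifting the images of the e_i,
    and the coordinates c_i make that lift well defined and linear. *)
Lemma dual_basis_fgp (R : pzRingType) (P : lmodType R) :
  has_dual_basis P -> fin_gen P /\ projective P.
Proof.
case=> I [e [c ec]]; split.
  by apply: (@fin_gen_index _ _ I e) => x; exists (c^~ x).
move=> M N g f g_surj.
have [y yP] := fin_all_exists (fun i => g_surj (f (e i))).
have hL : linear (fun x => \sum_i (c i x : R) *: y i).
  move=> a u v; rewrite scaler_sumr -big_split; apply: eq_bigr => i _ /=.
  by rewrite linearP /= scalerDl scalerA.
exists (lhom_of hL) => x /=; rewrite [in RHS](ec x) !linear_sum.
by apply: eq_bigr => i _; rewrite !linearZ /= yP.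
Qed.

Lemma fgp_dual_basis (R : pzRingType) (P : lmodType R) :
  fin_gen P -> projective P -> has_dual_basis P.
Proof.
move=> [m [e eP]] prP.
have gL : linear (fun v : 'rV[R]_m => \sum_i v 0 i *: e i).
  move=> a u v; rewrite scaler_sumr -big_split; apply: eq_bigr => i _ /=.
  by rewrite !mxE scalerDl scalerA.
have g_surj y : exists v, lhom_of gL v = y.
  have [c ->] := eP y; exists (\row_i c i) => /=.
  by apply: eq_bigr => i _; rewrite mxE.
have [h hP] := prP _ _ (lhom_of gL) [the {linear P -> P} of idfun] g_surj.
have cL i : linear (fun x => h x 0 i : R^o).
  by move=> a u v; rewrite linearP !mxE.
by exists 'I_m, e, (fun i => lhom_of (cL i)) => x; rewrite -{1}[x]hP.
Qed.

(** The identity of P factors through a finite power of Q, so P is a direct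
    summand of that power; phrasing this with the components f_i, g_i avoids
    forming the power. *)
Lemma dual_basis_retract (R : pzRingType) (P Q : lmodType R) (I : finType)
    (f : I -> {linear Q -> P}) (g : I -> {linear P -> Q}) :
  (forall x, x = \sum_i f i (g i x)) -> has_dual_basis Q -> has_dual_basis P.
Proof.
move=> fg [J [e [c ec]]].
have hL (p : I * J) : linear (fun x => c p.2 (g p.1 x)).
  by move=> a u v; rewrite !linearP.
exists (I * J)%type, (fun p => f p.1 (e p.2)), (fun p => lhom_of (hL p)) => x.
rewrite -(pair_bigA _ (fun i j => (c j (g i x) : R) *: f i (e j))) /=.
rewrite {1}[x]fg; apply: eq_bigr => i _.
by rewrite {1}[g i x]ec linear_sum; apply: eq_bigr => j _; rewrite linearZ.
Qed.

Lemma dual_basis_iso (R : pzRingType) (P Q : lmodType R) (f : Q -> P)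
    (g : P -> Q) :
  linear f -> linear g -> cancel g f -> has_dual_basis Q -> has_dual_basis P.
Proof.
move=> fL gL gK.
apply: (@dual_basis_retract _ _ _ unit (fun=> lhom_of fL) (fun=> lhom_of gL)).
by move=> x; rewrite big_const card_unit /= addr0 gK.
Qed.

Lemma fin_gen_restr (k : comPzRingType) (S : pzAlgType k) (M : lmodType S) :
  fin_gen (kmod S) -> fin_gen M -> fin_gen (restr M).
Proof.
move=> [m [g gP]] [l [e eP]].
apply: (@fin_gen_index _ _ ('I_l * 'I_m)%type
          (fun p => ((g p.2 : S) *: e p.1 : M) : restr M)) => x.
have [s sP] := eP x.
have [c cP] := fin_all_exists (fun i => gP (s i)).
exists (fun p => c p.1 p.2).
rewrite -(pair_bigA _ (fun i j => c i j *: (((g j : S) *: e i : M) : restr M))).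
rewrite [LHS]sP; apply: eq_bigr => i _ /=.
rewrite [s i]cP [LHS]scaler_suml; apply: eq_bigr => j _.
by rewrite -[LHS]scalerA.
Qed.

Lemma fin_gen_of_restr (k : comPzRingType) (S : pzAlgType k) (M : lmodType S) :
  fin_gen (restr M) -> fin_gen M.
Proof.
move=> [m [e eP]]; exists m, e => x; have [c cP] := eP x.
by exists (fun i => alg_map (c i)); rewrite [LHS]cP.
Qed.

(** Coordinates in a basis are linear because they are unique. *)
Lemma fin_free_dual_basis (R : pzRingType) (M : lmodType R) :
  fin_free M -> has_dual_basis M.
Proof.
move=> [m [e /(_ _)/cid-/all_sig[c cP]]].
have cL i : linear (fun x => c x 0 i : R^o).
  move=> a x y.
  have -> : c (a *: x + y) = a *: c x + c y.
    apply: (cP _).2; rewrite {1}[x](cP _).1 {1}[y](cP _).1.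
    rewrite scaler_sumr -big_split; apply: eq_bigr => j _ /=.
    by rewrite !mxE scalerDl scalerA.
  by rewrite !mxE.
by exists 'I_m, e, (fun i => lhom_of (cL i)) => x; apply: (cP x).1.
Qed.

(** * Generalities on categories and linear categories *)

Lemma nat_iso_sym (C D : category) (F G : functor C D) :
  nat_iso F G -> nat_iso G F.
Proof.
move=> [eta [theta [nat te et]]]; exists theta, eta; split=> // X Y f.
rewrite -[LHS]comp_idr -(et X) !compA -[comp (comp _ _) (eta X)]compA -nat.
by rewrite compA te comp_idl.
Qed.

Lemma linear_bij_inverse (R : pzRingType) (U V : lmodType R)
    (f : {linear U -> V}) :
  bijective f -> exists g : {linear V -> U}, cancel f g /\ cancel g f.
Proof.
move=> [g fK gK]; have gL : linear g.
  by move=> a x y; apply: (can_inj fK); rewrite gK linearP !gK.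
by exists (lhom_of gL).
Qed.

(** Naturality of the pointwise inverse is automatic; it is needed here
    because morphisms of functor categories carry their naturality proof. *)
Lemma nat_trans_bij_inverse (k : comPzRingType) (C : lin_category k)
    (F G : lin_functor C (fgp_category k)) (alpha : nat_trans F G) :
  (forall X, bijective (alpha X : {linear F X -> G X})) ->
  exists beta : nat_trans G F,
    nat_comp beta alpha = nat_id F /\ nat_comp alpha beta = nat_id G.
Proof.
move=> /(_ _)/linear_bij_inverse/cid-/all_sig[b bP].
have bN X Y (f : khom X Y) :
    lcomp (b Y : khom (G Y) (F Y)) (lfmap G X Y f) = lcomp (lfmap F X Y f) (b X).
  apply: lhom_ext => y /=; apply: (can_inj (bP Y).1); rewrite (bP Y).2.
  have /(congr1 (fun h : lhom _ _ => (h : {linear F X -> G Y}) (b X y))) /= -> :=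
    nt_natural alpha f.
  by rewrite (bP X).2.
exists (NatTrans bN); split; apply: nat_trans_ext => X; apply: lhom_ext => x /=.
  exact: (bP X).1.
exact: (bP X).2.
Qed.

Section LinearCategory.
Variables (k : comPzRingType) (C : lin_category k).
Implicit Types X Y Z : C.

Lemma lcomp_sumr X Y Z (I : Type) (r : seq I) (P : pred I)
    (g : khom Y Z) (f : I -> khom X Y) :
  lcomp g (\sum_(i <- r | P i) f i) = \sum_(i <- r | P i) lcomp g (f i).
Proof. exact: (linear_sum (lhom_of ((lcomp_bilinear X Y Z).2 g))). Qed.

Lemma lcompZl X Y Z a (g : khom Y Z) (f : khom X Y) :
  lcomp (a *: g) f = a *: lcomp g f.
Proof. exact: (linearZ_LR (lhom_of ((lcomp_bilinear X Y Z).1 f))). Qed.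

Lemma lcompDl X Y Z (g g' : khom Y Z) (f : khom X Y) :
  lcomp (g + g') f = lcomp g f + lcomp g' f.
Proof. exact: (linearD (lhom_of ((lcomp_bilinear X Y Z).1 f))). Qed.

Lemma lcompDr X Y Z (g : khom Y Z) (f f' : khom X Y) :
  lcomp g (f + f') = lcomp g f + lcomp g f'.
Proof. exact: (linearD (lhom_of ((lcomp_bilinear X Y Z).2 g))). Qed.

(** X is a direct summand of a finite power of X0 in the additive envelope of
    C; the factorization of the identity makes sense without direct sums. *)
Definition spanned_through (X0 X : C) : Prop :=
  exists (I : finType) (a : I -> khom X X0) (b : I -> khom X0 X),
    \sum_i lcomp (b i) (a i) = lidm X.

End LinearCategory.

(** * Morita equivalence over an object through which all identities factor *)

Section EndAction.
Variables (k : comPzRingType) (C : lin_category k) (X0 : C).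
Variables (S : pzAlgType k) (sigma : S -> khom X0 X0).

Record alg_iso : Prop := AlgIso {
  alg_iso_bij : bijective sigma;
  alg_isoD : {morph sigma : s t / s + t};
  alg_isoM : forall s t, sigma (s * t) = lcomp (sigma s) (sigma t);
  alg_iso_scal : forall c : k, sigma (alg_map c) = c *: lidm X0 }.

Hypothesis sigmaP : alg_iso.

Lemma alg_iso1 : sigma 1 = lidm X0.
Proof. by rewrite -(@alg_map1 k S) (alg_iso_scal sigmaP) scale1r. Qed.

(** Hom (X, X0) as a left S-module, through postcomposition with sigma.  The
    proof [phi] is an argument so that the module structure can be inferred
    from the type. *)
Definition hom_to (phi : alg_iso) (X : C) : Type := khom X X0.

Section HomTo.
Variable X : C.
Local Notation H := (hom_to sigmaP X).

HB.instance Definition _ := GRing.Zmodule.on H.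

Definition hom_to_scale (s : S) (g : H) : H := lcomp (sigma s) g.

Lemma hom_to_scaleA s t g :
  hom_to_scale s (hom_to_scale t g) = hom_to_scale (s * t) g.
Proof. by rewrite /hom_to_scale (alg_isoM sigmaP) lcompA. Qed.

Lemma hom_to_scale1 : left_id 1 hom_to_scale.
Proof. by move=> g; rewrite /hom_to_scale alg_iso1 lcomp_idl. Qed.

Lemma hom_to_scaleDr : right_distributive hom_to_scale +%R.
Proof. by move=> s g h; apply: lcompDr. Qed.

Lemma hom_to_scaleDl g : {morph hom_to_scale^~ g : s t / s + t}.
Proof.
by move=> s t; rewrite /hom_to_scale (alg_isoD sigmaP); apply: lcompDl.
Qed.

HB.instance Definition _ := GRing.Zmodule_isLmodule.Build S H
  hom_to_scaleA hom_to_scale1 hom_to_scaleDr hom_to_scaleDl.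

End HomTo.

(** F X0 as a left S-module, through F and sigma. *)
Definition value_at (phi : alg_iso)
  (F : lin_functor C (fgp_category k)) : Type := F X0.

Section ValueAt.
Variable F : lin_functor C (fgp_category k).
Local Notation V := (value_at sigmaP F).
Implicit Types x y : V.

HB.instance Definition _ := GRing.Zmodule.on V.

Definition value_scale (s : S) (x : V) : V :=
  (lfmap F X0 X0 (sigma s) : {linear F X0 -> F X0}) (x : F X0).

Lemma value_scaleA s t x : value_scale s (value_scale t x) = value_scale (s * t) x.
Proof. by rewrite /value_scale (alg_isoM sigmaP) lfmap_comp. Qed.

Lemma value_scale1 : left_id 1 value_scale.
Proof. by move=> x; rewrite /value_scale alg_iso1 lfmap_id. Qed.

Lemma value_scaleDr : right_distributive value_scale +%R.
Proof. by move=> s x y; rewrite /value_scale; apply: linearD. Qed.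

Lemma value_scaleDl x : {morph value_scale^~ x : s t / s + t}.
Proof.
by move=> s t; rewrite /value_scale (alg_isoD sigmaP) linearD.
Qed.

HB.instance Definition _ := GRing.Zmodule_isLmodule.Build S V
  value_scaleA value_scale1 value_scaleDr value_scaleDl.

(** Linearity of F makes the k-action inherited from S on F X0 agree with the
    original one, so finiteness over k can be transported. *)
Lemma value_restrE (c : k) (x : restr V) : c *: x = (c *: (x : F X0) : F X0).
Proof.
rewrite -[LHS]/(value_scale (alg_map c) x) /value_scale.
by rewrite (alg_iso_scal sigmaP) linearZ lfmap_id.
Qed.

Lemma value_at_fgp : fin_gen (restr V) /\ projective (restr V).
Proof.
apply: dual_basis_fgp.
apply: (@dual_basis_iso _ (restr V) (F X0) idfun idfun) => //.
- by move=> c x y; rewrite value_restrE.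
- by move=> c x y; rewrite value_restrE.
- by apply: fgp_dual_basis; [apply: fgp_fin_gen|apply: fgp_projective].
Qed.

End ValueAt.
End EndAction.

Section Morita.
Variables (k : comPzRingType) (C : lin_category k) (X0 : C).
Variables (S : pzAlgType k) (sigma : S -> khom X0 X0).
Hypothesis sigmaP : alg_iso sigma.
Hypothesis spanP : forall X : C, spanned_through X0 X.
Variable Q : lmodType S -> Prop.
Hypothesis QP : forall M, Q M <-> fin_gen (restr M) /\ projective (restr M).

Local Notation LF := (lin_functor_category C (fgp_category k)).
Local Notation MC := (module_category Q).
Local Notation ev F := (value_at sigmaP F : lmodType S).
Local Notation ht X := (hom_to sigmaP X : lmodType S).

Lemma eval_hom_linear (F G : lin_functor C (fgp_category k))
    (alpha : nat_trans F G) :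
  linear ((alpha X0 : {linear F X0 -> G X0}) : ev F -> ev G).
Proof.
move=> s x y.
have /(congr1 (fun h : lhom _ _ => (h : {linear F X0 -> G X0}) x)) /= E :=
  nt_natural alpha (sigma s).
by rewrite linearD; congr (_ + _); exact: E.
Qed.

Definition eval_hom F G (alpha : nat_trans F G) : lhom (ev F) (ev G) :=
  lhom_of (eval_hom_linear alpha).

Definition eval_obj (F : LF) : MC :=
  exist _ (ev F) ((QP _).2 (value_at_fgp sigmaP F)).

Lemma eval_hom_id (F : LF) : eval_hom (idm F) = idm (eval_obj F).
Proof. exact: lhom_ext. Qed.

Lemma eval_hom_comp (F G H : LF) (b : hom G H) (a : hom F G) :
  eval_hom (comp b a) = lhom_comp (eval_hom b) (eval_hom a).
Proof. exact: lhom_ext. Qed.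

Definition eval_functor : functor LF MC :=
  @Functor LF MC eval_obj eval_hom eval_hom_id eval_hom_comp.

Lemma hom_to_alg_map X (c : k) (g : khom X X0) :
  alg_map c *: (g : ht X) = (c *: g : khom X X0).
Proof.
by rewrite -[LHS]/(lcomp (sigma _) g) (alg_iso_scal sigmaP) lcompZl lcomp_idl.
Qed.

Lemma hom_linear_scale X (N : lmodType S) (h : {linear ht X -> N}) (c : k)
    (g : khom X X0) : h (c *: g) = alg_map c *: h g.
Proof. by rewrite -hom_to_alg_map linearZ. Qed.

Section Coinduced.
Variable M : MC.
Local Notation N := (sval M).
Local Notation coind_mod X := (lhom (ht X) N).

Lemma precomp_linear X Y (f : khom X Y) :
  linear ((fun g => lcomp g f) : ht Y -> ht X).
Proof.
by move=> s g h; rewrite [LHS]lcompDl -[X in X + _ = _]lcompA.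
Qed.

Definition precomp X Y (f : khom X Y) : lhom (ht Y) (ht X) :=
  lhom_of (precomp_linear f).

Lemma lcomp_to_linear X (b : khom X0 X) (m : N) tau : cancel tau sigma ->
  cancel sigma tau -> linear (fun g : ht X => (tau (lcomp g b) : S) *: m).
Proof.
move=> tK sK s g h; rewrite scalerA -scalerDl; congr (_ *: _).
apply: (can_inj sK); rewrite (alg_isoD sigmaP) (alg_isoM sigmaP) !tK.
by rewrite [LHS]lcompDl -[X in X + _ = _]lcompA.
Qed.

(** With id_X = sum_i b_i a_i, an S-linear map h : Hom (X, X0) -> M satisfies
    h g = sum_i (g b_i) (h a_i), as g b_i is in S; so h depends linearly on
    the finitely many h a_i in M, and Hom_S (Hom (X, X0), M) is a summand of
    a finite power of M over k. *)
Lemma coind_fgp X : fin_gen (coind_mod X) /\ projective (coind_mod X).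
Proof.
apply: dual_basis_fgp; have [I [a [b ab]]] := spanP X.
have [tau sK tK] := alg_iso_bij sigmaP.
pose f i (m : restr N) : coind_mod X := lhom_of (lcomp_to_linear (b i) m tK sK).
pose g i (h : coind_mod X) : restr N := (h : {linear ht X -> N}) (a i).
have fL i : linear (f i).
  move=> c m m'; apply: lhom_ext => x /=; rewrite scalerDr; congr (_ + _).
  by rewrite -[c *: m]/(alg_map c *: (m : N)) [LHS]scalerA -alg_mapC -[LHS]scalerA.
have gL i : linear (g i) by [].
apply: (@dual_basis_retract _ _ (restr N) I
          (fun i => lhom_of (fL i)) (fun i => lhom_of (gL i))); last first.
  by have [? ?] := (QP N).1 (svalP M); apply: fgp_dual_basis.
move=> h; apply: lhom_ext => x /=.
pose evx (u : coind_mod X) := (u : {linear ht X -> N}) x : restr N.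
have evL : linear evx by [].
rewrite -[RHS]/(lhom_of evL _) linear_sum /= /evx /g.
rewrite -[x in LHS]lcomp_idr -ab lcomp_sumr.
rewrite linear_sum; apply: eq_bigr => i _ /=.
by rewrite -linearZ /= lcompA -[X in _ = _ X]/(lcomp (sigma _) _) tK.
Qed.

Definition coind_obj X : fgp_module k :=
  FgpModule (coind_fgp X).1 (coind_fgp X).2.

Lemma coind_precomp_linear X Y (f : khom X Y) :
  linear (fun h : coind_obj X => lhom_comp h (precomp f) : coind_obj Y).
Proof. exact: (lhom_comp_bilinear _ _ _).1. Qed.

Definition coind_precomp X Y (f : khom X Y) : lhom (coind_obj X) (coind_obj Y) :=
  lhom_of (coind_precomp_linear f).

Lemma coind_map_linear X Y : linear (@coind_precomp X Y).
Proof.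
move=> c f f'; apply: lhom_ext => h; apply: lhom_ext => g /=.
have hD : {morph (h : {linear ht X -> N}) : u v / u + v} := linearD _.
by rewrite (lcomp_bilinear _ _ _).2 hD hom_linear_scale.
Qed.

Definition coind_map X Y : {linear khom X Y -> lhom (coind_obj X) (coind_obj Y)} :=
  lhom_of (@coind_map_linear X Y).

Lemma coind_map_id X : coind_map X X (lidm X) = lhom_id (coind_obj X).
Proof.
by apply: lhom_ext => h; apply: lhom_ext => g /=; rewrite lcomp_idr.
Qed.

Lemma coind_map_comp X Y Z (g : khom Y Z) (f : khom X Y) :
  coind_map X Z (lcomp g f) = lhom_comp (coind_map Y Z g) (coind_map X Y f).
Proof.
by apply: lhom_ext => h; apply: lhom_ext => u /=; rewrite lcompA.
Qed.

Definition coind : LF :=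
  @LinFunctor k C (fgp_category k) coind_obj coind_map coind_map_id coind_map_comp.

End Coinduced.

Lemma coind_hom_linear (M N : MC) (phi : hom M N) X :
  linear (fun h : coind_obj M X => lhom_comp phi h : coind_obj N X).
Proof. exact: (lhom_comp_bilinear _ _ _).2. Qed.

Definition coind_hom_at (M N : MC) (phi : hom M N) X :
  lhom (coind_obj M X) (coind_obj N X) := lhom_of (@coind_hom_linear M N phi X).

Lemma coind_hom_natural (M N : MC) (phi : hom M N) X Y (f : khom X Y) :
  lhom_comp (coind_hom_at phi Y) (lfmap (coind M) X Y f) =
  lhom_comp (lfmap (coind N) X Y f) (coind_hom_at phi X).
Proof. by apply: lhom_ext => h; apply: lhom_ext. Qed.

Definition coind_hom (M N : MC) (phi : hom M N) :
    nat_trans (coind M) (coind N) :=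
  @NatTrans k C (fgp_category k) (coind M) (coind N) (coind_hom_at phi)
    (coind_hom_natural phi).

Lemma coind_hom_id M : coind_hom (idm M) = nat_id (coind M).
Proof.
by apply: nat_trans_ext => X; apply: lhom_ext => h; apply: lhom_ext.
Qed.

Lemma coind_hom_comp M N P (b : hom N P) (a : hom M N) :
  coind_hom (comp b a) = nat_comp (coind_hom b) (coind_hom a).
Proof.
by apply: nat_trans_ext => X; apply: lhom_ext => h; apply: lhom_ext.
Qed.

Definition coind_functor : functor MC LF :=
  @Functor MC LF coind coind_hom coind_hom_id coind_hom_comp.

Section Unit.
Variable F : LF.
Local Notation F' := (F : lin_functor C (fgp_category k)).
Local Notation CF := (coind (eval_obj F)).

Lemma unit_val_linear X (x : F' X) :
  linear (fun g : ht X =>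
            (lfmap F' X X0 g : {linear F' X -> F' X0}) x : ev F').
Proof.
move=> s g h.
rewrite -[_ *: g]/(lcomp (sigma s) g) linearD; congr (_ + _).
by rewrite lfmap_comp.
Qed.

Definition unit_val X (x : F' X) : lhom (ht X) (ev F') :=
  lhom_of (unit_val_linear x).

Lemma unit_at_linear X : linear (@unit_val X : F' X -> coind_obj (eval_obj F) X).
Proof.
move=> c x y; apply: lhom_ext => g /=; rewrite linearD linearZ /=.
congr (_ + _); symmetry.
exact: (@value_restrE _ _ _ _ _ sigmaP F' c).
Qed.

Definition unit_at X : lhom (F' X) (coind_obj (eval_obj F) X) :=
  lhom_of (@unit_at_linear X).

Lemma unit_natural X Y (f : khom X Y) :
  lhom_comp (unit_at Y) (lfmap F' X Y f) =
  lhom_comp (lfmap CF X Y f) (unit_at X).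
Proof.
apply: lhom_ext => x; apply: lhom_ext => g /=.
by rewrite lfmap_comp.
Qed.

Definition unit_trans : nat_trans F' CF :=
  @NatTrans k C (fgp_category k) F' CF unit_at unit_natural.

(** Injectivity and surjectivity both come from inserting id_X = sum_i b_i a_i,
    to the right of g in the second case: g b_i then is an element of S and
    can be pulled out of the S-linear map h. *)
Lemma unit_bij X : bijective (unit_at X : {linear F' X -> coind_obj (eval_obj F) X}).
Proof.
have [I [a [b ab]]] := spanP X.
exists (fun h : coind_obj (eval_obj F) X =>
  \sum_i (lfmap F' X0 X (b i) : {linear F' X0 -> F' X})
           ((h : {linear ht X -> ev F'}) (a i) : F' X0)).
  move=> x /=.
  transitivity ((lfmap F' X X (lidm X) : {linear F' X -> F' X}) x).
    rewrite -ab linear_sum.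
    have evL : linear (fun u : lhom (F' X) (F' X) =>
                         (u : {linear F' X -> F' X}) x) by [].
    rewrite -[RHS]/(lhom_of evL _) linear_sum; apply: eq_bigr => i _ /=.
    by rewrite lfmap_comp.
  by rewrite lfmap_id.
move=> h; apply: lhom_ext => g /=; rewrite linear_sum.
have [tau sK tK] := alg_iso_bij sigmaP.
rewrite -[g in RHS]lcomp_idr -ab lcomp_sumr.
rewrite [RHS](linear_sum (h : {linear ht X -> ev F'})).
apply: eq_bigr => i _.
pose s := tau (lcomp g (b i)).
have -> : lcomp g (lcomp (b i) (a i)) = (s *: (a i : ht X) : ht X).
  by rewrite -[RHS]/(lcomp (sigma s) (a i)) tK lcompA.
rewrite linearZ /=.
rewrite -[RHS]/((lfmap F' X0 X0 (sigma s) : {linear F' X0 -> F' X0}) _) tK.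
by rewrite lfmap_comp.
Qed.

End Unit.

Lemma unit_trans_natural (F G : LF) (alpha : hom F G) :
  nat_comp (unit_trans G) alpha =
  nat_comp (coind_hom (eval_hom alpha : hom (eval_obj F) (eval_obj G)))
           (unit_trans F).
Proof.
apply: nat_trans_ext => X; apply: lhom_ext => x; apply: lhom_ext => g /=.
have /(congr1 (fun h : lhom _ _ => (h : {linear F X -> G X0}) x)) /= -> :=
  nt_natural (alpha : nat_trans _ _) (g : khom X X0).
by [].
Qed.

Lemma eval_coind_unit : nat_iso (functor_id LF) (functor_comp coind_functor eval_functor).
Proof.
have inv F := @nat_trans_bij_inverse _ _ _ _ (unit_trans F) (@unit_bij F).
have [theta thetaP] := all_sig (fun F => cid (inv F)).
exists unit_trans, theta; split.
- exact: unit_trans_natural.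
- by move=> F; have [] := thetaP F.
- by move=> F; have [] := thetaP F.
Qed.

Lemma counit_linear (M : MC) :
  linear (fun h : ev (coind M) =>
    (h : {linear ht X0 -> sval M}) (lidm X0 : ht X0)).
Proof.
move=> s g h /=.
rewrite -[LHS]/((g : {linear ht X0 -> sval M}) (lcomp (lidm X0) (sigma s))
                + (h : {linear ht X0 -> sval M}) (lidm X0)).
congr (_ + _); rewrite lcomp_idl -linearZ; congr (g _).
by rewrite -[RHS]/(lcomp (sigma s) (lidm X0)) lcomp_idr.
Qed.

Definition counit (M : MC) : hom (eval_obj (coind M)) M :=
  lhom_of (@counit_linear M).

(** Hom (X0, X0) is the regular module S, so an S-linear map on it is
    determined by its value at the identity, which is arbitrary. *)
Lemma counit_bij (M : MC) :
  bijective (counit M : {linear ev (coind M) -> sval M}).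
Proof.
have [tau sK tK] := alg_iso_bij sigmaP.
exists (fun m => lhom_of (lcomp_to_linear (lidm X0) m tK sK)) => [h|m] /=.
  apply: lhom_ext => g /=; rewrite lcomp_idr -linearZ /=; congr (h _).
  by rewrite -[LHS]/(lcomp (sigma (tau g)) (lidm X0)) tK lcomp_idr.
by rewrite lcomp_idl -(alg_iso1 sigmaP) sK scale1r.
Qed.

Lemma coind_eval_counit :
  nat_iso (functor_comp eval_functor coind_functor) (functor_id MC).
Proof.
have inv M := linear_bij_inverse (@counit_bij M).
have [theta thetaP] := all_sig (fun M => cid (inv M)).
exists counit, theta; split.
- by move=> M N phi; apply: lhom_ext.
- by move=> M; apply: lhom_ext; apply: (thetaP M).1.
- by move=> M; apply: lhom_ext; apply: (thetaP M).2.
Qed.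

(** The condition on Q says exactly which S-modules can be values F X0. *)
Theorem morita_equivalence : equivalent LF MC.
Proof.
exists eval_functor, coind_functor; split; last exact: coind_eval_counit.
exact/nat_iso_sym/eval_coind_unit.
Qed.

End Morita.

(** * Multilinear maps and symmetric tensors *)

Section Multilinear.
Variables (k : pzRingType) (d : nat) (M W : lmodType k).
Variable phi : {ffun 'I_d -> M} -> W.
Hypothesis phiP : multilinear phi.

Lemma upd_same (v : {ffun 'I_d -> M}) i : upd v i (v i) = v.
Proof. by apply/ffunP => j; rewrite ffunE; case: eqP => // ->. Qed.

Lemma multilinear_slot (v : {ffun _}) i : linear (fun x => phi (upd v i x)).
Proof. by move=> c x y; apply: phiP. Qed.

Lemma multilinear0 (v : {ffun _}) i : v i = 0 -> phi v = 0.
Proof.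
move=> vi0; rewrite -(upd_same v i) vi0.
exact: (linear0 (lhom_of (multilinear_slot v i))).
Qed.

(** Induction on the set r of slots still to be expanded: outside r, the
    family F is concentrated at the single index c i.  To expand slot i, F is
    cut into families F_j whose slot i is concentrated at j.  Keeping all
    words w in every sum avoids any reindexing: the unwanted words contribute
    zero. *)
Lemma multilinear_sum_concentrated (J : finType) (r : seq 'I_d)
    (F : 'I_d -> J -> M) (c : 'I_d -> J) :
  (forall i j, i \notin r -> j != c i -> F i j = 0) ->
  phi [ffun i => \sum_j F i j] = \sum_(w : {ffun 'I_d -> J}) phi [ffun i => F i (w i)].
Proof.
elim: r F c => [|i r IHr] F c Fc.
  (* Only the word c contributes: any other one has a zero slot. *)
  rewrite (bigD1 [ffun i => c i]) //= big1 => [|w].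
    rewrite addr0; congr phi; apply/ffunP => i; rewrite !ffunE.
    by rewrite (bigD1 (c i)) //= big1 ?addr0 // => j; apply: Fc.
  move=> /eqP/ffunP wc; apply/eqP; apply: contraTT isT => phi0.
  case: wc => i; rewrite !ffunE; apply/eqP; apply: contraNT phi0 => wi.
  by apply/eqP/(@multilinear0 _ i); rewrite ffunE Fc.
pose Fj j i' j' := if i' != i then F i' j' else if j' == j then F i j else 0.
have Fjc j i' j' : i' \notin r -> j' != (if i' == i then j else c i') ->
    Fj j i' j' = 0.
  rewrite /Fj; case: (eqVneq i' i) => [_ _ /negPf -> //|i'i i'r j'c] /=.
  by rewrite Fc // inE negb_or i'i.
set V := [ffun i' => \sum_j F i' j].
have -> : phi V = \sum_j phi (upd V i (F i j)).
  rewrite -[in LHS](upd_same V i) [V i]ffunE.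
  exact: (linear_sum (lhom_of (multilinear_slot V i))).
transitivity (\sum_j \sum_(w : {ffun 'I_d -> J}) phi [ffun i' => Fj j i' (w i')]).
  apply: eq_bigr => j _; rewrite -(IHr _ _ (Fjc j)); congr phi.
  apply/ffunP => i'; rewrite !ffunE /Fj; case: eqP => //= _.
  by rewrite (bigD1 j) //= eqxx big1 ?addr0 // => j' /negPf ->.
rewrite exchange_big; apply: eq_bigr => w _; rewrite (bigD1 (w i)) //= big1.
  rewrite addr0; congr phi; apply/ffunP => i'; rewrite !ffunE /Fj.
  by case: eqP => [->|//]; rewrite eqxx.
move=> j wj; apply: (@multilinear0 _ i); rewrite ffunE /Fj eqxx /=.
by rewrite eq_sym (negPf wj).
Qed.

Lemma multilinear_sum (J : finType) (F : 'I_d -> J -> M) : (0 < d)%N ->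
  phi [ffun i => \sum_j F i j] = \sum_(w : {ffun 'I_d -> J}) phi [ffun i => F i (w i)].
Proof.
move=> d_gt0; pose i0 := Ordinal d_gt0; case: (pickP J) => [j0 _|J0].
  apply: (@multilinear_sum_concentrated _ (enum 'I_d) _ (fun=> j0)) => i j.
  by rewrite mem_enum.
rewrite (@multilinear0 _ i0); last by rewrite ffunE big_pred0.
by rewrite big_pred0 // => w; have := J0 (w i0).
Qed.

End Multilinear.

Lemma multilinear_scale (k : comPzRingType) (d : nat) (M W : lmodType k)
    (phi : {ffun 'I_d -> M} -> W) (a : 'I_d -> k) (v : {ffun 'I_d -> M}) :
  multilinear phi ->
  phi [ffun i => a i *: v i] = (\prod_i a i) *: phi v.
Proof.
move=> phiP.
suff scale_on r : uniq r ->
    phi [ffun i => if i \in r then a i *: v i else v i] =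
    (\prod_(i <- r) a i) *: phi v.
  rewrite -big_enum /= -(scale_on _ (enum_uniq _)); congr phi.
  by apply/ffunP => i; rewrite !ffunE mem_enum.
elim: r => [_|i r IHr /= /andP[ir r_uniq]].
  by rewrite big_nil scale1r; congr phi; apply/ffunP => i; rewrite ffunE.
rewrite big_cons -scalerA -(IHr r_uniq).
set v' := [ffun j => if j \in r then _ else _].
rewrite -[v' in RHS](upd_same _ i) -[RHS](linearZ_LR (lhom_of (multilinear_slot phiP v' i))).
congr phi; apply/ffunP => j; rewrite !ffunE inE.
by case: eqP => [->|//] /=; rewrite (negPf ir).
Qed.

Section SymmetricTensors.
Variables (k : comPzRingType) (d : nat) (M : lmodType k) (J : finType).
Implicit Types (w : {ffun 'I_d -> J}) (u : J -> M) (s : 'S_d).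

Definition shuffle s w : {ffun 'I_d -> J} := [ffun i => w (s i)].

Lemma shuffleK s : cancel (shuffle s) (shuffle (s^-1)%g).
Proof. by move=> w; apply/ffunP => i; rewrite !ffunE permKV. Qed.

Lemma shuffleVK s : cancel (shuffle (s^-1)%g) (shuffle s).
Proof. by move=> w; apply/ffunP => i; rewrite !ffunE permK. Qed.

(** A permutation of the places permutes the words having a given label.  The
    label will be the orbit of the word, which gives generators of the
    invariants, or its set of letters. *)
Lemma sum_label_tsym (T : eqType) (label : {ffun 'I_d -> J} -> T) u t :
  (forall s w, label (shuffle s w) = label w) ->
  \sum_(w | label w == t) tpure [ffun i => u (w i)] \in @tsym k d M.
Proof.
move=> labelP; apply/tsymP => s.
rewrite [LHS](linear_sum (lhom_of (@tact_linear k d M s))) /=.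
rewrite [RHS](reindex (shuffle s)) /=; last first.
  by exists (shuffle (s^-1)%g) => w _; rewrite ?shuffleK ?shuffleVK.
apply: eq_big => w; first by rewrite labelP.
move=> _; rewrite tact_pure; congr tpure.
by apply/ffunP => i; rewrite !ffunE.
Qed.

Definition word_orbit w : {set {ffun 'I_d -> J}} :=
  [set shuffle s w | s in [set: 'S_d]].

Lemma word_orbit_shuffle s w : word_orbit (shuffle s w) = word_orbit w.
Proof.
have shuffleM p q v : shuffle p (shuffle q v) = shuffle (p * q)%g v.
  by apply/ffunP => i; rewrite !ffunE permM.
apply/setP => v; apply/imsetP/imsetP => [] [p _ ->].
  by exists (p * s)%g; rewrite ?inE.
by exists (p * s^-1)%g; rewrite ?inE ?shuffleM -?mulgA ?mulVg ?mulg1.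
Qed.

Lemma word_orbit_eq w w' : word_orbit w = word_orbit w' ->
  exists s, w = shuffle s w'.
Proof.
move=> ww'; have : w \in word_orbit w'.
  rewrite -ww'; apply/imsetP; exists 1%g; rewrite ?inE //.
  by apply/ffunP => i; rewrite ffunE perm1.
by case/imsetP => s _ ->; exists s.
Qed.

Section Coordinates.
Variables (e : J -> M) (c : J -> {linear M -> k^o}).
Hypothesis ec : dual_basis e c.
Hypothesis d_gt0 : (0 < d)%N.

Definition coord_prod w (v : {ffun 'I_d -> M}) : k^o := \prod_i c (w i) (v i).

Lemma coord_prod_multilinear w : multilinear (coord_prod w).
Proof.
move=> v i a x y; pose p := \prod_(j | j != i) (c (w j) (v j) : k).
have pE z : coord_prod w (upd v i z) = (c (w i) z : k) * p.
  rewrite /coord_prod (bigD1 i) //= ffunE eqxx; congr (_ * _).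
  by apply: eq_bigr => j /negPf ji; rewrite ffunE ji.
by rewrite !pE linearP mulrDl -mulrA.
Qed.

Definition tcoord w : tpow d M -> k^o := tlift (coord_prod w).

Lemma tcoord_linear w : linear (tcoord w).
Proof. exact/tlift_linear/coord_prod_multilinear. Qed.

(** Words in the e_j with products of the c_j as coordinates form a dual basis
    of the tensor power: expand each factor v_i in its dual basis. *)
Lemma tcoord_dual (x : tpow d M) :
  x = \sum_w (tcoord w x : k) *: tpure [ffun i => e (w i)].
Proof.
have sumL : linear (fun x => \sum_w (tcoord w x : k) *:
                              (tpure [ffun i => e (w i)] : tpow d M)).
  move=> a y z; rewrite scaler_sumr -big_split; apply: eq_bigr => w _ /=.
  by rewrite tcoord_linear scalerDl scalerA.
apply: (tpow_ext (f := id) _ sumL) => // v.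
have -> : v = [ffun i => \sum_j (c j (v i) : k) *: e j].
  by apply/ffunP => i; rewrite ffunE -ec.
rewrite {1}(multilinear_sum (@tpure_multilinear k d M)) //.
apply: eq_bigr => w _.
rewrite /tcoord (tlift_pure (@coord_prod_multilinear w)).
have -> : [ffun i => (c (w i) (v i) : k) *: e (w i)] =
   [ffun i => (c (w i) (v i) : k) *: [ffun i => e (w i)] i].
  by apply/ffunP => i; rewrite !ffunE.
rewrite (multilinear_scale _ _ (@tpure_multilinear k d M)); congr (_ *: _).
by apply: eq_bigr => i _; rewrite ffunE -ec.
Qed.

Lemma tcoord_shuffle s w (x : tpow d M) :
  x \in @tsym k d M -> tcoord (shuffle s w) x = tcoord w x.
Proof.
move/tsymP/(_ s) => {1}<-; move: x; apply: tpow_ext => [a x y|a x y|v].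
- by rewrite tact_linear tcoord_linear.
- exact: tcoord_linear.
rewrite tact_pure /tcoord !(tlift_pure (@coord_prod_multilinear _)).
rewrite /coord_prod [RHS](reindex_inj (@perm_inj _ s)) /=.
by apply: eq_bigr => i _; rewrite !ffunE.
Qed.

(** The coordinates of an invariant tensor are constant on orbits of words, so
    it is a combination of orbit sums. *)
Lemma gamma_dual_basis_fin_gen : fin_gen (gamma d M).
Proof.
(* The type of O contains sets that are no orbits; their sum is empty. *)
pose orbit_sum O := Gamma (@sum_label_tsym _ word_orbit e O word_orbit_shuffle).
apply: (@fin_gen_index _ _ _ orbit_sum) => x.
pose w_ O := [pick w | word_orbit w == O].
exists (fun O => if w_ O is Some w then tcoord w (gval x) else 0).
have gvalL : linear (@gval k d M) by [].
apply: val_inj; rewrite /= [LHS]tcoord_dual.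
rewrite -[RHS]/(lhom_of gvalL _) linear_sum /=.
rewrite (partition_big word_orbit predT) //=; apply: eq_bigr => O _.
rewrite -[RHS]/(_ *: gval (orbit_sum O)) /= scaler_sumr.
apply: eq_bigr => w /eqP wO; rewrite /w_.
case: pickP => [w' /eqP|/(_ w)]; last by rewrite wO eqxx.
rewrite -wO => /word_orbit_eq[s ->].
by rewrite tcoord_shuffle ?gvalP.
Qed.

End Coordinates.
End SymmetricTensors.

(** * Factoring the identities of a divided power category *)

Lemma inj_on_small_set (J : finType) (n : nat) (T : {set J}) :
  (0 < n)%N -> (#|T| <= n)%N ->
  exists f : J -> 'I_n, {in T &, injective f}.
Proof.
case: n => // n _ T_le; exists (fun t => inord (index t (enum T))) => s t sT tT.
have lt_n u : u \in T -> (index u (enum T) < n.+1)%N.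
  by move=> uT; apply: leq_trans T_le; rewrite cardE index_mem mem_enum.
move=> /(congr1 val) /=; rewrite !inordK ?lt_n // => st.
have nthK u : u \in T -> nth s (enum T) (index u (enum T)) = u.
  by move=> uT; rewrite nth_index ?mem_enum.
by rewrite -[LHS]nthK // st nthK.
Qed.

Section DividedPowerSpan.
Variables (k : comPzRingType) (C : lin_category k) (X0 X : C) (n d : nat).
Variables (J : finType) (x : J -> 'I_n -> khom X X0) (y : J -> 'I_n -> khom X0 X).
Variable eps : J -> khom X X.
Hypothesis xy_diag : forall j i, lcomp (y j i) (x j i) = eps j.
Hypothesis xy_orth : forall j l i i', i != i' -> lcomp (y j i) (x l i') = 0.
Hypothesis eps_sum : \sum_j eps j = lidm X.
Hypotheses (d_gt0 : (0 < d)%N) (d_le_n : (d <= n)%N).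

(** Here X0 behaves like a sum of n copies of one object: the factorization of
    eps_j may be routed through any slot i, and distinct slots do not
    interact.  Since a tensor of d maps eps_(w i) has at most d <= n distinct
    letters, they can be routed through distinct slots, and then a single map
    X -> X0 used in all d places serves all the words with the same set of
    letters. *)
Lemma divided_power_spanned :
  @spanned_through k (gamma_category d C) X0 X.
Proof.
have n_gt0 := leq_trans d_gt0 d_le_n.
pose support (w : {ffun 'I_d -> J}) := [set w i | i in [set: 'I_d]].
have support_shuffle s w : support (shuffle s w) = support w.
  apply/setP => j; apply/imsetP/imsetP => [] [i _ ->].
    by exists (s i); rewrite ?inE // ffunE.
  by exists ((s^-1)%g i); rewrite ?inE // ffunE permKV.
have support_small w : (#|support w| <= n)%N.
  by apply: leq_trans d_le_n; rewrite (leq_trans (leq_imset_card _ _)) ?cardsT ?card_ord.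
(* For sets with more than n letters the slots are arbitrary: no word has such
   a support, so the corresponding summand is zero. *)
have /fin_all_exists[slot slot_inj] (T : {set J}) : exists f : J -> 'I_n,
    (#|T| <= n)%N -> {in T &, injective f}.
  case: (leqP #|T| n) => [/(inj_on_small_set n_gt0)[f fT]|]; first by exists f.
  by exists (fun=> Ordinal n_gt0).
pose a (T : {set J}) := gpure d (\sum_(t in T) x t (slot T t)).
pose b (T : {set J}) := Gamma (@sum_label_tsym k d _ J _ support (fun j => y j (slot T j)) T
                     support_shuffle).
exists {set J}, a, b; apply: val_inj.
have gvalL : linear (@gval k d (khom X X)) by [].
rewrite -[LHS]/(lhom_of gvalL _) linear_sum /=.
have -> : tpure [ffun=> lidm X] =
    \sum_(w : {ffun 'I_d -> J}) tpure [ffun i => eps (w i)] :> tpow d _.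
  rewrite -(multilinear_sum (@tpure_multilinear k d _) (fun=> eps)) //.
  by congr tpure; apply/ffunP => i; rewrite !ffunE eps_sum.
rewrite [RHS](partition_big support predT) //=; apply: eq_bigr => T _.
have tL := (tbilin_bilinear (d := d) (lcomp_bilinear X X0 X)).1 (gval (a T)).
rewrite -[LHS]/(lhom_of tL _) linear_sum /=; apply: eq_bigr => w /eqP wT.
rewrite tbilin_pure; last exact: lcomp_bilinear.
congr tpure; apply/ffunP => i; rewrite !ffunE lcomp_sumr.
have wiT : w i \in T by rewrite -wT; apply/imsetP; exists i.
rewrite (bigD1 (w i)) //= xy_diag big1 ?addr0 // => t /andP[tT tw].
apply: xy_orth; apply: contraNneq tw => /slot_inj; rewrite -wT in wiT tT *.
by move=> ->.
Qed.

End DividedPowerSpan.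

(** * Divided powers of algebra isomorphisms *)

Section GammaMap.
Variables (k : comPzRingType) (d : nat).

Section Map.
Variables (M N : lmodType k) (f : {linear M -> N}).

Definition tmap_pure (v : {ffun 'I_d -> M}) : tpow d N :=
  tpure [ffun i => f (v i)].

Lemma tmap_pure_multilinear : multilinear tmap_pure.
Proof.
move=> v i c x y; have E z : [ffun j => f (upd v i z j)] =
    upd [ffun j => f (v j)] i (f z).
  by apply/ffunP => j; rewrite !ffunE; case: eqP.
by rewrite /tmap_pure !E linearP tpure_multilinear.
Qed.

Definition tmap : tpow d M -> tpow d N := tlift tmap_pure.

Lemma tmap_linear : linear tmap.
Proof. exact/tlift_linear/tmap_pure_multilinear. Qed.

Lemma tmapE v : tmap (tpure v) = tpure [ffun i => f (v i)].
Proof. exact/tlift_pure/tmap_pure_multilinear. Qed.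

Lemma tmap_sym (x : gamma d M) : tmap (gval x) \in @tsym k d N.
Proof.
apply/tsymP => s; rewrite -[in RHS](tsymP _ (gvalP x) s).
move: (gval x); apply: tpow_ext => [c y z|c y z|v].
- by rewrite tmap_linear tact_linear.
- by rewrite tact_linear tmap_linear.
by rewrite tact_pure !tmapE tact_pure; congr tpure; apply/ffunP => i; rewrite !ffunE.
Qed.

Definition gmap (x : gamma d M) : gamma d N := Gamma (tmap_sym x).

Lemma gmap_linear : linear gmap.
Proof. by move=> c x y; apply: val_inj; apply: tmap_linear. Qed.

Lemma gmap_pure m : gmap (gpure d m) = gpure d (f m).
Proof.
by apply: val_inj; rewrite /= tmapE; congr tpure; apply/ffunP => i; rewrite !ffunE.
Qed.

End Map.

Lemma gmapK (M N : lmodType k) (f : {linear M -> N}) (g : {linear N -> M}) :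
  cancel f g -> cancel (gmap f) (gmap g).
Proof.
move=> fK x; apply: val_inj => /=; move: (gval x).
apply: tpow_ext => [c y z|//|v]; first by rewrite !tmap_linear.
by rewrite !tmapE; congr tpure; apply/ffunP => i; rewrite !ffunE fK.
Qed.

Lemma gmap_gbilin (M1 M2 M3 N1 N2 N3 : lmodType k)
    (b : M1 -> M2 -> M3) (b' : N1 -> N2 -> N3)
    (bP : bilinear_map b) (b'P : bilinear_map b')
    (f1 : {linear M1 -> N1}) (f2 : {linear M2 -> N2}) (f3 : {linear M3 -> N3}) :
  (forall x y, f3 (b x y) = b' (f1 x) (f2 y)) ->
  forall x y, gmap f3 (gbilin bP x y) = gbilin b'P (gmap f1 x) (gmap f2 y).
Proof.
move=> fb x y; apply: val_inj => /=; move: (gval x) (gval y) => {x y} x.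
have [bl br] := tbilin_bilinear (d := d) bP.
have [bl' br'] := tbilin_bilinear (d := d) b'P.
move=> y; move: x; apply: tpow_ext => [c x z|c x z|v].
- by rewrite bl tmap_linear.
- by rewrite tmap_linear bl'.
move: y; apply: tpow_ext => [c x z|c x z|w].
- by rewrite br tmap_linear.
- by rewrite tmap_linear br'.
rewrite !tmapE !tbilin_pure // !tmapE; congr tpure.
by apply/ffunP => i; rewrite !ffunE.
Qed.

Lemma gmap_alg_iso (B : pzAlgType k) (C : lin_category k) (X : C)
    (f : {linear kmod B -> khom X X}) (g : khom X X -> kmod B) :
  cancel f g -> cancel g f ->
  (forall x y : B, f (x * y) = lcomp (f x) (f y)) -> f (1 : B) = lidm X ->
  @alg_iso k (gamma_category d C) X (gamma_alg d B) (gmap f).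
Proof.
move=> fK gK fM f1.
have [h [fhK hfK]] := linear_bij_inverse (Bijective fK gK).
split.
- by exists (gmap h); apply: gmapK.
- by move=> x y; rewrite -[x]scale1r gmap_linear !scale1r.
- by move=> x y; apply: gmap_gbilin.
move=> c.
rewrite -[LHS]/(gmap f (c *: galg_one d B)).
rewrite [LHS](linearZ_LR (lhom_of (gmap_linear f))); congr (_ *: _).
by rewrite [LHS]gmap_pure f1.
Qed.

End GammaMap.

(** * Free modules, matrices and the Schur algebra *)

Section FreeModule.
Variables (k : comPzRingType) (A : pzAlgType k) (n : nat).
Local Notation An := ('rV[A^c]_n : lmodType A^c).

Definition unit_row (i : 'I_n) (a : A^c) : 'rV[A^c]_n :=
  \row_j (if j == i then a else 0).

Lemma unit_row_linear i : linear (unit_row i : (A^c)^o -> An).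
Proof.
move=> a x y; apply/rowP => j; rewrite !mxE; case: eqP => // _.
by rewrite mulr0 addr0.
Qed.

Lemma row_sum_units (v : An) : v = \sum_i v 0 i *: unit_row i 1.
Proof.
apply/rowP => j; rewrite summxE (bigD1 j) //= big1 => [|i /negPf ij].
  by rewrite !mxE eqxx addr0 mulr1.
by rewrite !mxE eq_sym ij mulr0.
Qed.

Lemma row_entry_linear (i : 'I_n) : linear (fun v : An => v 0 i : (A^c)^o).
Proof. by move=> a x y; rewrite !mxE. Qed.

Lemma free_has_dual_basis : has_dual_basis An.
Proof.
exists 'I_n, (fun i => unit_row i 1), (fun i => lhom_of (row_entry_linear i)).
exact: row_sum_units.
Qed.

Definition free_fgp : fgp_module A^c :=
  FgpModule (dual_basis_fgp free_has_dual_basis).1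
            (dual_basis_fgp free_has_dual_basis).2.

(** Right A-modules are left modules over the converse ring, so scaling by a
    in A^c multiplies the entries of a row on the right, and matrices over A
    can act on the left without transposition. *)
Lemma mxact_linear (X : 'M[A]_n) :
  linear (fun v : An => \row_i \sum_j X i j * (v 0 j : A) : An).
Proof.
move=> a u v; apply/rowP => i; rewrite !mxE mulr_sumr -big_split.
by apply: eq_bigr => j _; rewrite !mxE mulrDr mulrA.
Qed.

Definition mxact (X : 'M[A]_n) : lhom An An := lhom_of (mxact_linear X).

Lemma mxact_klinear : linear (mxact : kmod 'M[A]_n -> lhom An An).
Proof.
move=> c X Y; apply: lhom_ext => v /=; apply/rowP => i; rewrite !mxE.
rewrite mulr_sumr -big_split; apply: eq_bigr => j _ /=.
rewrite !mxE mulrDl; congr (_ + _).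
rewrite (bigD1 i) //= big1 => [|l li]; last by rewrite !mxE eq_sym (negPf li) mul0r.
by rewrite !mxE eqxx addr0 -mulrA alg_mapC.
Qed.

Definition mxact_inv (h : lhom An An) : kmod 'M[A]_n :=
  \matrix_(i, j) (h : {linear An -> An}) (unit_row j 1) 0 i.

Lemma mxactK : cancel mxact mxact_inv.
Proof.
move=> X; apply/matrixP => i j; rewrite !mxE (bigD1 j) //= big1 => [|l lj].
  by rewrite mxE eqxx mulr1 addr0.
by rewrite mxE (negPf lj) mulr0.
Qed.

Lemma mxact_invK : cancel mxact_inv mxact.
Proof.
move=> h; apply: lhom_ext => v /=; rewrite [v in RHS]row_sum_units linear_sum.
apply/rowP => i; rewrite !mxE summxE; apply: eq_bigr => j _.
by rewrite linearZ !mxE.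
Qed.

Lemma mxactM (X Y : 'M[A]_n) : mxact (X * Y) = lhom_comp (mxact X) (mxact Y).
Proof.
apply: lhom_ext => v /=; apply/rowP => i; rewrite !mxE.
transitivity (\sum_j \sum_l X i l * Y l j * (v 0 j : A)).
  by apply: eq_bigr => j _; rewrite mxE mulr_suml.
rewrite exchange_big; apply: eq_bigr => l _; rewrite mxE mulr_sumr.
by apply: eq_bigr => j _; rewrite mulrA.
Qed.

Lemma mxact1 : mxact 1 = lhom_id An.
Proof.
apply: lhom_ext => v /=; apply/rowP => i; rewrite !mxE.
rewrite (bigD1 i) //= big1 => [|l li].
  by rewrite mxE eqxx mul1r addr0.
by rewrite mxE eq_sym (negPf li) mul0r.
Qed.

Lemma matrix_dual_basis :
  has_dual_basis (kmod A) -> has_dual_basis (kmod 'M[A]_n).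
Proof.
pose unit_mx (p : 'I_n * 'I_n) (a : kmod A) : kmod 'M[A]_n :=
  (\matrix_(i, j) (if (i, j) == p then a else 0) : 'M[A]_n).
have scaleE (c : k) (X : kmod 'M[A]_n) i j :
    (c *: X : 'M[A]_n) i j = alg_map c * (X : 'M[A]_n) i j.
  rewrite mxE (bigD1 i) //= big1 => [|l li].
    by rewrite !mxE eqxx addr0.
  by rewrite mxE eq_sym (negPf li) mul0r.
have unitL p : linear (unit_mx p).
  move=> c x y; apply/matrixP => i j; rewrite [RHS]mxE scaleE !mxE.
  by case: eqP => // _; rewrite mulr0 addr0.
have entryL (p : 'I_n * 'I_n) : linear (fun X : kmod 'M[A]_n => (X : 'M[A]_n) p.1 p.2 : kmod A).
  by move=> c X Y; rewrite [LHS]mxE scaleE.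
apply: (@dual_basis_retract _ _ _ _ (fun p => lhom_of (unitL p))
                            (fun p => lhom_of (entryL p))) => X.
apply/matrixP => i j; rewrite summxE (bigD1 (i, j)) //= big1 => [|p pij].
  by rewrite mxE eqxx addr0.
by rewrite mxE eq_sym (negPf pij).
Qed.

End FreeModule.

Section Schur.
Variables (k : comPzRingType) (A : pzAlgType k) (n d : nat).
Hypotheses (d_gt0 : (0 < d)%N) (d_le_n : (d <= n)%N).

(** The maps through slot i of A^n are u |-> (c_j u in slot i) and
    v |-> v_i e_j, for a dual basis e_j, c_j of X. *)
Lemma free_spans_gamma (X : fgp_category A^c) :
  @spanned_through k (gamma_category d (fgp_category A^c)) (free_fgp A n) X.
Proof.
have [J [e [c ec]]] := fgp_dual_basis (@fgp_fin_gen _ X) (@fgp_projective _ X).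
have xL j i : linear (fun u : (X : fgp_module _) => unit_row i (c j u) : 'rV[A^c]_n).
  by move=> a u v; rewrite linearP; apply: unit_row_linear.
have yL j i : linear (fun v : 'rV[A^c]_n => (v 0 i : A^c) *: e j).
  by move=> a u v; rewrite !mxE scalerDl scalerA.
have epsL j : linear (fun u => (c j u : A^c) *: e j).
  by move=> a u v; rewrite linearP scalerDl scalerA.
apply: (@divided_power_spanned k (fgp_category A^c) (free_fgp A n) X n d J
  (fun j i => lhom_of (xL j i)) (fun j i => lhom_of (yL j i))
  (fun j => lhom_of (epsL j))) => // [j i|j l i i' ii'|].
- by apply: lhom_ext => u /=; rewrite !mxE eqxx.
- by apply: lhom_ext => u /=; rewrite !mxE (negPf ii') scale0r.
apply: lhom_ext => u /=.
have evL : linear (fun f : lhom (X : fgp_module _) (X : fgp_module _) =>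
  (f : {linear (X : fgp_module _) -> (X : fgp_module _)}) u : restr (X : fgp_module _)).
  by [].
by rewrite -[LHS]/(lhom_of evL _) linear_sum /= -ec.
Qed.

Lemma schur_end_iso :
  @alg_iso k (gamma_category d (fgp_category A^c)) (free_fgp A n)
    (schur_alg A n d) (gmap (lhom_of (@mxact_klinear k A n))).
Proof.
apply: (@gmap_alg_iso k d 'M[A]_n (fgp_category A^c) (free_fgp A n)
          (lhom_of (@mxact_klinear k A n)) (@mxact_inv k A n)).
- exact: mxactK.
- exact: mxact_invK.
- exact: mxactM.
- exact: mxact1.
Qed.

Lemma schur_fin_gen : fin_free (kmod A) -> fin_gen (kmod (schur_alg A n d)).
Proof.
move=> /fin_free_dual_basis/(matrix_dual_basis n)[J [e [c ec]]].
have [m [g gP]] := gamma_dual_basis_fin_gen ec d_gt0.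
exists m, g => x; have [a ->] := gP x; exists a; apply: eq_bigr => i _.
rewrite -[RHS]/(alg_map (a i) * (g i : schur_alg A n d)).
by rewrite -[alg_map _]/(a i *: (1 : schur_alg A n d)) galg_scaleAl mul1r.
Qed.

End Schur.

Local Close Scope ring_scope.

Theorem theorem4p4 (k : comPzRingType) (A : pzAlgType k) (n d : nat)
    (A_free : fin_free (kmod A))
    (n_gt0 : 0 < n) (d_gt0 : 0 < d) (d_le_n : d <= n) :
  equivalent (poly_functors d (fgp_category A^c))
             (fg_kproj_mod (schur_alg A n d))
  /\
  ((forall M : lmodType k, fin_gen M -> projective M) ->
   equivalent (poly_functors d (fgp_category A^c))
              (fg_mod (schur_alg A n d))).
Proof.
have fgS := schur_fin_gen n d_gt0 A_free.
have equiv := morita_equivalence (schur_end_iso A n d)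
                (free_spans_gamma d_gt0 d_le_n).
split=> [|proj]; apply: equiv => M.
  by split=> [[fgM prM]|[fgM prM]]; split=> //;
     [apply: fin_gen_restr | apply: fin_gen_of_restr].
split=> [fgM|[fgM _]]; last exact: fin_gen_of_restr.
by split; [|apply: proj]; apply: fin_gen_restr.
Qed.
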